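(* Let $T$ be an affine theory such that for every tuple of variables $x$ the set $\mathcal E_x(T)$ of extreme types is closed in $S^{\mathrm{aff}}_x(T)$. Let $M,N$ be extremal models of $T$. Then: (1) if $M\preceq^{\mathrm{aff}}N$, then $M\preceq^{\mathrm{cont}}N$; (2) if $M\equiv^{\mathrm{aff}}N$, then $M\equiv^{\mathrm{cont}}N$. In particular, if $T$ is complete as an affine theory, then $T_{\mathrm{ext}}$ is complete as a continuous logic theory.
   Context: Affine logic is the fragment of continuous logic (with convex continuity moduli) whose formulas are built from atomic formulas by real affine combinations and the quantifiers $\sup,\inf$; continuous formulas allow all continuous connectives. An affine theory is a set of conditions between affine sentences. $S^{\mathrm{aff}}_x(T)$: compact convex set of affine types ($\varphi\mapsto\varphi^M(a)$, $\varphi$ affine) of $x$-tuples in models of $T$, with pointwise topology; $\mathcal E_x(T)$ its extreme points. $M\models T$ is extremal if every finite tuple of $M$ has an extreme type. $M\preceq^{\mathrm{aff}}N$ ($M\preceq^{\mathrm{cont}}N$): $M$ is a substructure of $N$ and all affine (resp. continuous) formulas with parameters in $M$ take the same value in $M$ and $N$; $\equiv^{\mathrm{aff}}$, $\equiv^{\mathrm{cont}}$ mean the same values of all affine (resp. continuous) sentences. $T$ is complete if all its models are affinely equivalent. $T_{\mathrm{ext}}$ is the common continuous logic theory of all extremal models of $T$. *)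

(* Defs.v *)
From HB Require Import structures.
From mathcomp Require Import all_boot all_order all_algebra.
From mathcomp Require Import all_classical all_reals all_analysis.

Set Implicit Arguments.
Unset Strict Implicit.
Unset Printing Implicit Defensive.

Import Order.TTheory GRing.Theory Num.Theory.
Import numFieldNormedType.Exports.

Local Open Scope classical_set_scope.
Local Open Scope ring_scope.

(* A modulus [D] bounds the variation of a symbol from above, as a function of
   the distances between the arguments: |P a - P b| <= D (d (a_i, b_i))_i.
   In this convention the moduli called convex (meaning that the tolerance
   delta(eps) allowed on the arguments is a convex function of eps) are the
   concave functions D.  Only the values of [D] on nonnegative tuples matter. *)
Definition convex_modulus (R : realType) (n : nat) (D : ('I_n -> R) -> R) :=
  [/\ D (fun=> 0) = 0,
      forall e, 0 < e -> exists2 d, 0 < d &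
        forall s, (forall i, 0 <= s i < d) -> D s < e,
      forall s t, (forall i, 0 <= s i <= t i) -> D s <= D t
    & forall s t l, (forall i, 0 <= s i) -> (forall i, 0 <= t i) ->
        0 <= l <= 1 ->
        l * D s + (1 - l) * D t <= D (fun i => l * s i + (1 - l) * t i)].

Record signature (R : realType) := Signature {
  dist_bound : R;
  fun_symb : Type;
  fun_arity : fun_symb -> nat;
  fun_modulus : forall f, ('I_(fun_arity f) -> R) -> R;
  fun_modulusP : forall f, convex_modulus (@fun_modulus f);
  pred_symb : Type;
  pred_arity : pred_symb -> nat;
  pred_modulus : forall P, ('I_(pred_arity P) -> R) -> R;
  pred_modulusP : forall P, convex_modulus (@pred_modulus P);
  pred_lower : pred_symb -> R;
  pred_upper : pred_symb -> R }.

(* Completeness is spelled out because the library does not join [metricType]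
   and [completeType]. *)
Record structure (R : realType) (L : signature R) := Structure {
  carrier :> metricType R;
  carrier_nonempty : [set: carrier] !=set0;
  carrier_complete : forall F : set_system carrier,
    ProperFilter F -> cauchy F -> exists x : carrier, F --> x;
  carrier_bounded : forall x y : carrier, mdist x y <= dist_bound L;
  fun_interp : forall f : fun_symb L, ('I_(fun_arity f) -> carrier) -> carrier;
  fun_interp_modulus : forall (f : fun_symb L) (a b : 'I_(fun_arity f) -> carrier),
    mdist (@fun_interp f a) (@fun_interp f b) <=
    @fun_modulus R L f (fun i => mdist (a i) (b i));
  pred_interp : forall P : pred_symb L, ('I_(pred_arity P) -> carrier) -> R;
  pred_interp_modulus : forall (P : pred_symb L) (a b : 'I_(pred_arity P) -> carrier),
    `|@pred_interp P a - @pred_interp P b| <=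
    @pred_modulus R L P (fun i => mdist (a i) (b i));
  pred_interp_bounded : forall (P : pred_symb L) (a : 'I_(pred_arity P) -> carrier),
    pred_lower P <= @pred_interp P a <= pred_upper P }.

Inductive term (R : realType) (L : signature R) (n : nat) : Type :=
| Var of 'I_n
| App (f : fun_symb L) of ('I_(fun_arity f) -> term L n).

Definition connectives (R : realType) := forall k : nat, set ('rV[R]_k -> R).

Definition affine_conn (R : realType) : connectives R :=
  fun k => [set u | exists (c : R) (r : 'I_k -> R),
    forall v : 'rV[R]_k, u v = c + \sum_(i < k) r i * v 0 i].

Definition continuous_conn (R : realType) : connectives R :=
  fun k => [set u | continuous u].

Arguments affine_conn {R} k _.
Arguments continuous_conn {R} k _.

(* Formulas in the variables x_0, ..., x_(n-1), with connectives in [K].  The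
   variable bound by a quantifier is x_0 of its body, whose variable x_(i+1)
   is the x_i of the quantified formula. *)
Inductive formula (R : realType) (L : signature R) (K : connectives R) :
  nat -> Type :=
| Dist n of term L n & term L n : formula L K n
| Pred n (P : pred_symb L) of ('I_(pred_arity P) -> term L n) : formula L K n
| Conn n k (u : 'rV[R]_k -> R) of K k u & ('I_k -> formula L K n) :
    formula L K n
| Sup n of formula L K n.+1 : formula L K n
| Inf n of formula L K n.+1 : formula L K n.

Definition env0 (M : Type) : 'I_0 -> M :=
  fun i => match i with Ordinal _ h => False_rect M (notF h) end.

Definition env_cons (M : Type) (n : nat) (b : M) (a : 'I_n -> M) :
    'I_n.+1 -> M :=
  fun i => oapp a b (unlift ord0 i).

Fixpoint term_val (R : realType) (L : signature R) (M : structure L) (n : nat)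
    (a : 'I_n -> M) (t : term L n) : M :=
  match t with
  | Var i => a i
  | App f ts => @fun_interp R L M f (fun i => term_val a (ts i))
  end.

Fixpoint form_val (R : realType) (L : signature R) (K : connectives R)
    (M : structure L) (n : nat) (phi : formula L K n) : ('I_n -> M) -> R :=
  match phi in formula _ _ n return ('I_n -> M) -> R with
  | Dist _ t1 t2 => fun a => mdist (term_val a t1) (term_val a t2)
  | Pred _ P ts => fun a => @pred_interp R L M P (fun i => term_val a (ts i))
  | Conn _ _ u _ phis => fun a => u (\row_i form_val (phis i) a)
  | Sup _ psi => fun a => sup (range (fun b => form_val psi (env_cons b a)))
  | Inf _ psi => fun a => inf (range (fun b => form_val psi (env_cons b a)))
  end.

Definition sentence_val (R : realType) (L : signature R) (K : connectives R)
    (M : structure L) (phi : formula L K 0) : R :=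
  form_val phi (@env0 M).

(* A pair (phi, psi) stands for the condition phi <= psi. *)
Definition theory (R : realType) (L : signature R) (K : connectives R) :=
  set (formula L K 0 * formula L K 0).

Definition holds_in (R : realType) (L : signature R) (K : connectives R)
    (M : structure L) (c : formula L K 0 * formula L K 0) :=
  sentence_val M c.1 <= sentence_val M c.2.

Definition model (R : realType) (L : signature R) (K : connectives R)
    (T : theory L K) (M : structure L) :=
  forall c, T c -> holds_in M c.

Definition equivalent (R : realType) (L : signature R) (K : connectives R)
    (M N : structure L) :=
  forall phi : formula L K 0, sentence_val M phi = sentence_val N phi.

Definition complete_theory (R : realType) (L : signature R)
    (K : connectives R) (T : theory L K) :=
  forall M N : structure L, model T M -> model T N -> equivalent K M N.

Definition embedding (R : realType) (L : signature R) (M N : structure L)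
    (h : M -> N) :=
  [/\ forall x y : M, mdist (h x) (h y) = mdist x y,
      forall (f : fun_symb L) (a : 'I_(fun_arity f) -> M),
        h (fun_interp a) = fun_interp (h \o a)
    & forall (P : pred_symb L) (a : 'I_(pred_arity P) -> M),
        pred_interp (h \o a) = pred_interp a].

(* [M] is an elementary substructure of [N] for the formulas with connectives
   in [K], the inclusion of [M] in [N] being [h]. *)
Definition elementary (R : realType) (L : signature R) (K : connectives R)
    (M N : structure L) (h : M -> N) :=
  embedding h /\
  forall (n : nat) (phi : formula L K n) (a : 'I_n -> M),
    form_val phi a = form_val phi (h \o a).

Definition closed_in (X : topologicalType) (A E : set X) :=
  closed (E : set (subspace A)).

Definition type_space (R : realType) (L : signature R) (n : nat) :=
  {ptws formula L affine_conn n -> R}.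

Definition aff_type (R : realType) (L : signature R) (M : structure L)
    (n : nat) (a : 'I_n -> M) : type_space L n :=
  fun phi => form_val phi a.

Definition aff_types (R : realType) (L : signature R)
    (T : theory L affine_conn) (n : nat) : set (type_space L n) :=
  [set p | exists (M : structure L) (a : 'I_n -> M),
    model T M /\ p = aff_type a].

Arguments aff_types {R L} T n _.

Definition extreme_types (R : realType) (L : signature R)
    (T : theory L affine_conn) (n : nat) : set (type_space L n) :=
  [set p | aff_types T n p /\
    forall (q r : type_space L n) (l : R),
      aff_types T n q -> aff_types T n r -> 0 < l < 1 ->
      (forall phi, p phi = l * q phi + (1 - l) * r phi) -> q = r].

Arguments extreme_types {R L} T n _.

Definition extremal_model (R : realType) (L : signature R)
    (T : theory L affine_conn) (M : structure L) :=
  model T M /\ forall (n : nat) (a : 'I_n -> M), extreme_types T n (aff_type a).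

Definition theory_ext (R : realType) (L : signature R)
    (T : theory L affine_conn) : theory L continuous_conn :=
  [set c | forall M : structure L, extremal_model T M -> holds_in M c].

(* Main.v *)
From HB Require Import structures.
Require Import Defs.
From mathcomp Require Import all_boot all_order all_algebra.
From mathcomp Require Import all_classical all_reals all_analysis.
From mathcomp Require Import ring lra.

(* On extremal models the value of a continuous formula is a continuous function
   of the extreme affine type, by induction on formulas; tuples with the same
   affine type then satisfy the same continuous formulas.  In the [Sup] step:
   - an extreme point q of the compact convex set of affine types has a
     neighbourhood basis of slices {psi > 0}, psi an affine formula; if
     psi(q) > 0 and q lies over p, then [Sup psi] is positive near p, so every
     tuple with type near p has a witness with type near q: this gives lower
     semicontinuity;
   - by compactness, types of witnesses over types converging to p accumulate at
     a type over p, extreme because the extreme types are closed: this gives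
     upper semicontinuity.
   Compactness comes from ultraproducts and convexity from weighted products
   l M + (1 - l) N; both are obtained from one construction, the quotient of a
   product of structures by the pseudometric m (d_i), m a mean. *)

Set Implicit Arguments.
Unset Strict Implicit.
Unset Printing Implicit Defensive.

Import Order.TTheory GRing.Theory Num.Theory.
Import numFieldNormedType.Exports.

Local Open Scope classical_set_scope.
Local Open Scope ring_scope.

(** * Bounded real functions and their suprema *)

Section BoundedFunctions.
Context {R : realType} {T : Type}.
Implicit Types (f g : T -> R).

Definition bounded_map f := exists B, forall x, `|f x| <= B.

Lemma bounded_map_cst (c : R) : bounded_map (fun=> c).
Proof. by exists `|c|. Qed.

Lemma bounded_mapD f g :
  bounded_map f -> bounded_map g -> bounded_map (fun x => f x + g x).
Proof.
move=> [B fB] [C gC]; exists (B + C) => x.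
by rewrite (le_trans (ler_normD _ _))// lerD.
Qed.

Lemma bounded_mapZ (c : R) f : bounded_map f -> bounded_map (fun x => c * f x).
Proof.
by move=> [B fB]; exists (`|c| * B) => x; rewrite normrM ler_wpM2l.
Qed.

Lemma bounded_mapN f : bounded_map f -> bounded_map (fun x => - f x).
Proof. by move=> [B fB]; exists B => x; rewrite normrN. Qed.

Lemma bounded_mapB f g :
  bounded_map f -> bounded_map g -> bounded_map (fun x => f x - g x).
Proof. by move=> fB /bounded_mapN gB; exact: bounded_mapD. Qed.

Lemma bounded_map_sum (I : Type) (s : seq I) (F : I -> T -> R) :
  (forall i, bounded_map (F i)) -> bounded_map (fun x => \sum_(i <- s) F i x).
Proof.
move=> FB; elim: s => [|i s IHs].
  by exists 0 => x; rewrite big_nil normr0.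
have [B hB] := bounded_mapD (FB i) IHs.
by exists B => x; rewrite big_cons.
Qed.

Lemma bounded_map_itv (c d : R) f : (forall x, c <= f x <= d) -> bounded_map f.
Proof.
move=> cfd; exists (`|c| + `|d|) => x; have /andP[cf fd] := cfd x.
rewrite ler_norml; apply/andP; split.
  have := ler_norm (- c); rewrite normrN; have := normr_ge0 d; lra.
have := ler_norm d; have := normr_ge0 c; lra.
Qed.

Lemma le_sup_range f x : bounded_map f -> f x <= sup (range f).
Proof.
move=> [B fB]; apply: ub_le_sup; last by exists x.
by exists B => _ [y _ <-]; exact: le_trans (ler_norm _) (fB y).
Qed.

Lemma sup_range_le f (c : R) : [set: T] !=set0 ->
  (forall x, f x <= c) -> sup (range f) <= c.
Proof.
move=> [t _] fc; apply: ge_sup; first by exists (f t), t.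
by move=> _ [y _ <-].
Qed.

Lemma sup_range_adherent f (e : R) : [set: T] !=set0 -> bounded_map f ->
  0 < e -> exists x, sup (range f) - e < f x.
Proof.
move=> [t _] [B fB] e0.
have [|_ [x _ <-] hx] := @sup_adherent _ (range f) e e0; last by exists x.
split; first by exists (f t), t.
by exists B => _ [y _ <-]; exact: le_trans (ler_norm _) (fB y).
Qed.

Lemma inf_rangeE f : inf (range f) = - sup (range (fun x => - f x)).
Proof. by rewrite /inf image_comp. Qed.

Lemma norm_sup_range_le f (B : R) : [set: T] !=set0 ->
  (forall x, `|f x| <= B) -> `|sup (range f)| <= B.
Proof.
move=> T0 fB; rewrite ler_norml; apply/andP; split; last first.
  by apply: sup_range_le => // x; exact: le_trans (ler_norm _) (fB x).
have [t _] := T0; apply: le_trans (_ : f t <= _).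
  by have := fB t; rewrite ler_norml => /andP[].
by apply: le_sup_range; exists B.
Qed.

End BoundedFunctions.

Lemma continuous_affine_comb (R : realType) (T : topologicalType) (I : Type)
    (s : seq I) (c : R) (r : I -> R) (F : I -> T -> R) :
  (forall i, continuous (F i)) ->
  continuous (fun x => c + \sum_(i <- s) r i * F i x).
Proof.
move=> cF x; apply: cvgD; first exact: cvg_cst.
apply: continuous_big => [|i _ y]; first exact: (@add_continuous R^o).
by apply: cvgMl_tmp; exact: cF.
Qed.

(** * Uniform bounds on the values of formulas *)

Section FormulaBounds.
Context {R : realType} (L : signature R).

Lemma norm_mdist (M : structure L) (x y : M) : `|mdist x y| <= dist_bound L.
Proof. by rewrite ger0_norm ?mdist_ge0// carrier_bounded. Qed.

Lemma continuous_box_bounded k (u : 'rV[R]_k -> R) (B : 'I_k -> R) :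
  continuous u ->
  exists C, forall v : 'rV[R]_k, (forall i, `|v 0 i| <= B i) -> `|u v| <= C.
Proof.
move=> cu; pose box := [set v : 'rV[R]_k | forall i, `[- B i, B i]%classic (v 0 i)].
have cbox : compact box.
  apply: (@rV_compact R^o k (fun i => `[- B i, B i]%classic)) => i.
  exact: segment_compact.
have /compact_bounded [C [Creal hC]] : compact (u @` box).
  by apply: continuous_compact => //; exact: continuous_subspaceT.
exists (C + 1) => v vB; apply: (hC (C + 1)); first by rewrite ltrDl.
by exists v => // i /=; rewrite in_itv/= -ler_norml.
Qed.

Lemma affine_conn_continuous k (u : 'rV[R]_k -> R) :
  affine_conn k u -> continuous_conn k u.
Proof.
move=> [c [r ur]]; rewrite (_ : u = fun v => c + \sum_(i < k) r i * v 0 i).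
  by apply: continuous_affine_comb => i; exact: coord_continuous.
exact/funext.
Qed.

(** One bound serves all structures at once, so the values of a formula along any family of
    structures form a bounded map, as means require. A connective is bounded on the compact box that
    contains the values of its arguments. *)
Lemma form_val_bounded (K : connectives R) :
  (forall k u, K k u -> continuous_conn k u) ->
  forall n (phi : formula L K n),
  exists B, forall (M : structure L) (a : 'I_n -> M), `|form_val phi a| <= B.
Proof.
move=> Kc n; elim => {n} [n t1 t2|n P ts|n k u Ku phis IH|n phi [B IH]|n phi [B IH]].
- by exists (dist_bound L) => M a; exact: norm_mdist.
- exists (`|pred_lower P| + `|pred_upper P|) => M a /=.
  have /andP[lP Pu] := pred_interp_bounded (fun i => term_val a (ts i)).
  rewrite ler_norml; apply/andP; split.
    have := ler_norm (- pred_lower P); rewrite normrN.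
    have := normr_ge0 (pred_upper P); lra.
  have := ler_norm (pred_upper P); have := normr_ge0 (pred_lower P); lra.
- have [B hB] := boolp.choice IH.
  have [C hC] := continuous_box_bounded B (Kc _ _ Ku).
  by exists C => M a /=; apply: hC => i; rewrite mxE.
- by exists B => M a /=; apply: norm_sup_range_le => //; exact: carrier_nonempty.
- exists B => M a /=; rewrite inf_rangeE normrN; apply: norm_sup_range_le.
    exact: carrier_nonempty.
  by move=> x; rewrite normrN.
Qed.

Lemma aff_val_bounded n (phi : formula L affine_conn n) :
  exists B, forall (M : structure L) (a : 'I_n -> M), `|form_val phi a| <= B.
Proof. exact: (form_val_bounded affine_conn_continuous). Qed.

End FormulaBounds.

(** * Means and products of structures *)

Section GeometricSequences.
Context {R : realType}.

Lemma geometric_lt (C e : R) : 0 < e -> exists n, C * 2^-1 ^+ n < e.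
Proof.
move=> e0.
have h : C * 2^-1 ^+ n @[n --> \oo] --> C * 0.
  apply: cvgMl_tmp; apply: cvg_expr.
  by rewrite ger0_norm ?invr_ge0// invf_lt1// ltr1n.
have [N _ /(_ N (leqnn N))] : \forall n \near \oo, C * 2^-1 ^+ n < e.
  by apply: (cvgr_lt (C * 0)) => //; rewrite mulr0.
by exists N.
Qed.

Lemma geometric_dist (M : metricType R) (x : nat -> M) (C : R) m n :
  0 <= C -> (m <= n)%N ->
  (forall k, (k < n)%N -> mdist (x k) (x k.+1) <= C * 2^-1 ^+ k) ->
  mdist (x m) (x n) <= 2 * C * 2^-1 ^+ m.
Proof.
move=> C0 mn xC.
(* The subtracted term makes the telescoping induction on [j] go through; it is dropped at the
   end. *)
suff h j : (m + j <= n)%N ->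
    mdist (x m) (x (m + j)%N) <= 2 * C * (2^-1 ^+ m - 2^-1 ^+ (m + j)).
  rewrite -(subnKC mn); apply: le_trans (h _ _) _; first by rewrite subnKC.
  apply: ler_wpM2l; first by rewrite mulr_ge0.
  by rewrite gerBl exprn_ge0// invr_ge0.
elim: j => [|j IHj] mjn; first by rewrite addn0 mdistxx subrr mulr0.
rewrite addnS in mjn *; apply: le_trans (metric_triangle _ (x (m + j)%N) _) _.
have := IHj (ltnW mjn); have := xC _ mjn; rewrite exprS.
have : 2 * 2^-1 = 1 :> R by rewrite mulfV.
set a := 2^-1 ^+ m; set b := 2^-1 ^+ (m + j); set h := 2^-1 => h2 h3 h4.
apply: le_trans (lerD h4 h3) _.
have -> : 2 * C * (a - b) + C * b = 2 * C * a - 2 * C * b + C * b by ring.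
have -> : 2 * C * (a - h * b) = 2 * C * a - (2 * h) * C * b by ring.
by rewrite h2; lra.
Qed.

Lemma geometric_lim (L : signature R) (M : structure L) (x : nat -> M) (C : R) :
  0 <= C -> (forall k, mdist (x k) (x k.+1) <= C * 2^-1 ^+ k) ->
  exists y, forall n, mdist (x n) y <= 2 * C * 2^-1 ^+ n.
Proof.
move=> C0 xC.
have cx : cauchy (x @ \oo).
  apply/cauchy_exP => e e0; have [N hN] := geometric_lt (2 * C) e0.
  exists (x N); exists N => // n /= Nn; rewrite ballEmdist /=.
  exact: le_lt_trans (geometric_dist C0 Nn (fun k _ => xC k)) hN.
have [y xy] := carrier_complete _ cx.
exists y => n; apply/ler_addgt0Pr => e e0.
have [N _ hN] : (x @ \oo) (ball y e) by apply: xy; exact: nbhsx_ballx.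
have := hN (maxn n N) (leq_maxr _ _); rewrite ballEmdist /= => yx.
apply: le_trans (metric_triangle _ (x (maxn n N)) _) _.
apply: lerD; last by rewrite metric_sym ltW.
exact: geometric_dist C0 (leq_maxl _ _) (fun k _ => xC k).
Qed.

(* [y] is the limit of the sequence frozen at the first index where the bound
   fails. *)
Lemma geometric_prefix_lim (L : signature R) (M : structure L) (x : nat -> M)
    (C : R) : 0 <= C ->
  exists y, forall n,
    (forall k, (k < n)%N -> mdist (x k) (x k.+1) <= C * 2^-1 ^+ k) ->
    mdist (x n) y <= 2 * C * 2^-1 ^+ n.
Proof.
move=> C0; have [all_k|] :=
  pselect (forall k, mdist (x k) (x k.+1) <= C * 2^-1 ^+ k).
  by have [y hy] := geometric_lim C0 all_k; exists y.
move=> /existsNP[k0 /negP nk0].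
have [k nk kmin] := ex_minnP (ex_intro (fun k => ~~ (mdist (x k) (x k.+1) <=
  C * 2^-1 ^+ k)) k0 nk0).
exists (x k) => n xn; apply: geometric_dist => //.
  by rewrite leqNgt; apply/negP => kn; rewrite xn in nk.
by move=> j jk; rewrite -[_ <= _]negbK; apply/negP => /kmin; rewrite leqNgt jk.
Qed.

End GeometricSequences.

(* The common generalization of an ultrafilter and of a finitely supported
   probability: an ultraproduct and a weighted product of structures are the
   same construction, for two different means. *)
Record mean (R : realType) (I : Type) := Mean {
  mean_val :> (I -> R) -> R;
  meanD : forall f g, bounded_map f -> bounded_map g ->
    mean_val (fun i => f i + g i) = mean_val f + mean_val g;
  meanZ : forall c f, bounded_map f ->
    mean_val (fun i => c * f i) = c * mean_val f;
  mean_le : forall f g, bounded_map f -> bounded_map g ->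
    (forall i, f i <= g i) -> mean_val f <= mean_val g;
  mean1 : mean_val (fun=> 1) = 1;
  (* A concave modulus need not be upper semicontinuous at the boundary of the
     orthant, so the bound on [h] must hold after splitting the coordinates. *)
  mean_modulus : forall n (D : ('I_n -> R) -> R) (s : 'I_n -> I -> R)
      (h : I -> R),
    convex_modulus D -> (forall j, bounded_map (s j)) ->
    (forall j i, 0 <= s j i) -> bounded_map h ->
    (forall (Z : pred 'I_n) i,
      h i <= D (fun j => if Z j then s j i else 0) +
             D (fun j => if Z j then 0 else s j i)) ->
    mean_val h <= D (fun j => mean_val (s j)) }.

(** * Elementary properties of means *)

Section MeanTheory.
Context {R : realType} {I : Type} (m : mean R I).

Lemma mean_cst (c : R) : m (fun=> c) = c.
Proof.
rewrite -[RHS]mulr1 -(mean1 m) -meanZ; last exact: bounded_map_cst.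
by congr (m _); apply/funext => i; rewrite mulr1.
Qed.

Lemma mean_itv (f : I -> R) (c d : R) :
  (forall i, c <= f i <= d) -> c <= m f <= d.
Proof.
move=> cfd; have fB := bounded_map_itv cfd.
apply/andP; split; [rewrite -[leLHS]mean_cst|rewrite -[leRHS]mean_cst];
  apply: mean_le => //; try exact: bounded_map_cst.
  by move=> i; have /andP[] := cfd i.
by move=> i; have /andP[] := cfd i.
Qed.

Lemma mean_norm (f : I -> R) (B : R) : (forall i, `|f i| <= B) -> `|m f| <= B.
Proof. by move=> fB; rewrite ler_norml; apply: mean_itv => i; rewrite -ler_norml. Qed.

Lemma meanN (g : I -> R) : bounded_map g -> m (fun i => - g i) = - m g.
Proof.
move=> gB; rewrite -mulN1r -meanZ//; congr (m _).
by apply/funext => i; rewrite mulN1r.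
Qed.

Lemma meanB (f g : I -> R) : bounded_map f -> bounded_map g ->
  m (fun i => f i - g i) = m f - m g.
Proof. by move=> fB gB; rewrite -(meanN gB) -meanD//; exact: bounded_mapN. Qed.

Lemma mean_comb (J : Type) (s : seq J) (c : R) (r : J -> R) (F : J -> I -> R) :
  (forall j, bounded_map (F j)) ->
  m (fun i => c + \sum_(j <- s) r j * F j i) = c + \sum_(j <- s) r j * m (F j).
Proof.
move=> FB; have rFB j : bounded_map (fun i => r j * F j i) by exact: bounded_mapZ.
rewrite meanD ?mean_cst//; [|exact: bounded_map_cst|exact: bounded_map_sum].
congr (_ + _); elim: s => [|j s IHs].
  by rewrite big_nil; under eq_fun do rewrite big_nil; rewrite mean_cst.
rewrite big_cons; under eq_fun do rewrite big_cons.
by rewrite meanD// ?meanZ ?IHs//; exact: bounded_map_sum.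
Qed.

End MeanTheory.

(** * The metric quotient of a product by the mean distance *)

Section MeanStructure.
Context {R : realType} {L : signature R} {I : Type} (m : mean R I).
Context (M : I -> structure L).

Local Notation P := (forall i, M i).

Definition pdist (x y : P) : R := m (fun i => mdist (x i) (y i)).

Lemma bounded_mdist (x y : P) : bounded_map (fun i => mdist (x i) (y i)).
Proof. by exists (dist_bound L) => i; exact: norm_mdist. Qed.

Lemma pdistxx x : pdist x x = 0.
Proof. by rewrite /pdist; under eq_fun do rewrite mdistxx; exact: mean_cst. Qed.

Lemma pdist_sym x y : pdist x y = pdist y x.
Proof. by rewrite /pdist; under eq_fun do rewrite metric_sym. Qed.

Lemma pdist_triangle y x z : pdist x z <= pdist x y + pdist y z.
Proof.
rewrite /pdist -meanD; try exact: bounded_mdist.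
apply: mean_le => [||i]; first exact: bounded_mdist.
  by apply: bounded_mapD; exact: bounded_mdist.
exact: metric_triangle.
Qed.

Lemma pdist_ge0 x y : 0 <= pdist x y.
Proof.
suff /andP[] : 0 <= pdist x y <= dist_bound L by [].
by apply: mean_itv => i; rewrite mdist_ge0 carrier_bounded.
Qed.

Lemma pdist0_trans y x z : pdist x y = 0 -> pdist y z = 0 -> pdist x z = 0.
Proof.
move=> xy yz; apply/eqP; rewrite eq_le pdist_ge0 andbT.
by have := pdist_triangle y x z; rewrite xy yz addr0.
Qed.

Lemma pdist0_eqr x y : pdist x y = 0 ->
  (fun z => pdist x z = 0) = (fun z => pdist y z = 0).
Proof.
move=> xy; apply/funext => z; apply/propext; split; apply: pdist0_trans => //.
by rewrite pdist_sym.
Qed.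

(** The choice is applied to the zero-distance class of [x], seen as a predicate: points at distance
    0 have equal predicates, hence the same chosen representative. *)
Definition pcanon (x : P) : P :=
  sval (cid (ex_intro (fun y => pdist x y = 0) x (pdistxx x))).

Lemma pdist_pcanon x : pdist x (pcanon x) = 0.
Proof. by rewrite /pcanon; case: cid. Qed.

Lemma pcanon_eq x y : pdist x y = 0 -> pcanon x = pcanon y.
Proof.
move=> /pdist0_eqr xy; rewrite /pcanon.
move: (ex_intro _ x _) (ex_intro _ y _); rewrite xy => p q.
by rewrite (Prop_irrelevance p q).
Qed.

(** The quotient is encoded as the set of canonical representatives, so that equality of classes is
    equality of representatives. *)
Record mean_quot := MeanQuot { mrep : P; mrepP : pcanon mrep = mrep }.

Lemma pcanonK x : pcanon (pcanon x) = pcanon x.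
Proof. exact/esym/pcanon_eq/pdist_pcanon. Qed.

Definition mclass (x : P) : mean_quot := MeanQuot (pcanonK x).

Lemma mrep_inj p q : mrep p = mrep q -> p = q.
Proof.
by case: p q => [x px] [y py] /= xy; subst y; rewrite (Prop_irrelevance px py).
Qed.

Lemma mclass_eq x y : pdist x y = 0 -> mclass x = mclass y.
Proof. by move=> xy; apply: mrep_inj; exact: pcanon_eq. Qed.

Lemma mrepK p : mclass (mrep p) = p.
Proof. by apply: mrep_inj; exact: mrepP. Qed.

Lemma pdist_mclass x y : pdist (mrep (mclass x)) (mrep (mclass y)) = pdist x y.
Proof.
have xx := pdist_pcanon x; have yy := pdist_pcanon y.
have e1 := pdist_triangle (pcanon x) x (pcanon y).
have e2 := pdist_triangle x (pcanon x) (pcanon y).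
have e3 := pdist_triangle (pcanon y) x y.
have e4 := pdist_triangle y x (pcanon y).
rewrite (pdist_sym (pcanon x) x) in e2; rewrite (pdist_sym (pcanon y) y) in e3.
apply/eqP; rewrite eq_le /=; apply/andP; split; lra.
Qed.

HB.instance Definition _ := gen_eqMixin mean_quot.
HB.instance Definition _ := gen_choiceMixin mean_quot.

Definition quot_dist (p q : mean_quot) : R := pdist (mrep p) (mrep q).

Lemma quot_distxx p : quot_dist p p = 0.
Proof. exact: pdistxx. Qed.

Lemma quot_dist_positivity p q : quot_dist p q = 0 -> p = q.
Proof. by move=> pq; rewrite -[p]mrepK -[q]mrepK; exact: mclass_eq. Qed.

Lemma quot_dist_sym p q : quot_dist p q = quot_dist q p.
Proof. exact: pdist_sym. Qed.

Lemma quot_dist_triangle q p r : quot_dist p r <= quot_dist p q + quot_dist q r.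
Proof. exact: pdist_triangle. Qed.

HB.instance Definition _ := isMetric.Build R mean_quot
  quot_distxx quot_dist_positivity quot_dist_sym quot_dist_triangle.

Lemma mdist_quotE (p q : mean_quot) : mdist p q = pdist (mrep p) (mrep q).
Proof. by []. Qed.

Lemma mdist_mclass x y : mdist (mclass x) (mclass y) = pdist x y.
Proof. by rewrite mdist_quotE pdist_mclass. Qed.

End MeanStructure.

(** Sequences with geometric steps suffice for the completeness of the quotient. The limit is asked
    for in the product, before passing to classes, and is built differently for ultrafilters and for
    weighted pairs. *)
Definition mean_complete (R : realType) (L : signature R) (I : Type)
    (m : mean R I) (M : I -> structure L) :=
  forall x : nat -> forall i, M i,
    (forall k, pdist m (x k) (x k.+1) <= 2^-1 ^+ k) ->
    exists y C, forall k, pdist m (x k) y <= C * 2^-1 ^+ k.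

Section SplitModulus.
Context {R : realType} {L : signature R} (M : structure L).

(** The way from [a] to [b] is broken at the tuple [c], which takes its coordinates in [Z] from [b];
    each half moves the coordinates on one side of the splitting only. This yields the split bound
    that [mean_modulus] assumes. *)
Lemma mdist_split n (D : ('I_n -> R) -> R) (Z : pred 'I_n) (a b : 'I_n -> M) :
  let c j := if Z j then b j else a j in
  D (fun j => mdist (a j) (c j)) + D (fun j => mdist (c j) (b j)) =
  D (fun j => if Z j then mdist (a j) (b j) else 0) +
  D (fun j => if Z j then 0 else mdist (a j) (b j)).
Proof.
by congr (D _ + D _); apply/funext => j; case: (Z j) => //; rewrite mdistxx.
Qed.

Lemma fun_interp_split (f : fun_symb L) (Z : pred 'I_(fun_arity f))
    (a b : 'I_(fun_arity f) -> M) :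
  mdist (fun_interp a) (fun_interp b) <=
  @fun_modulus R L f (fun j => if Z j then mdist (a j) (b j) else 0) +
  @fun_modulus R L f (fun j => if Z j then 0 else mdist (a j) (b j)).
Proof.
rewrite -(mdist_split (@fun_modulus R L f) Z a b).
apply: le_trans (metric_triangle _ _ _) (lerD _ _); exact: fun_interp_modulus.
Qed.

Lemma pred_interp_split (P : pred_symb L) (Z : pred 'I_(pred_arity P))
    (a b : 'I_(pred_arity P) -> M) :
  `|pred_interp a - pred_interp b| <=
  @pred_modulus R L P (fun j => if Z j then mdist (a j) (b j) else 0) +
  @pred_modulus R L P (fun j => if Z j then 0 else mdist (a j) (b j)).
Proof.
rewrite -(mdist_split (@pred_modulus R L P) Z a b).
apply: le_trans (ler_distD (pred_interp (fun j => if Z j then b j else a j)) _ _)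
  (lerD _ _); exact: pred_interp_modulus.
Qed.

End SplitModulus.

(** * The quotient as a structure and the values of affine formulas in it *)

Section MeanStructureDef.
Context {R : realType} {L : signature R} {I : Type} (m : mean R I).
Context (M : I -> structure L) (Mc : mean_complete m M).

Local Notation Q := (mean_quot m M).

Lemma quot_nonempty : [set: Q] !=set0.
Proof.
exists (mclass m (fun i => sval (cid (carrier_nonempty (M i))))).
by [].
Qed.

Lemma quot_complete (F : set_system Q) :
  ProperFilter F -> cauchy F -> exists x : Q, F --> x.
Proof.
move=> FF /cauchyP Fc.
have half_gt0 k : 0 < 2^-1 ^+ k :> R by rewrite exprn_gt0 ?invr_gt0.
(* The ball of radius 2^-(k+1) around [q k] belongs to [F]; consecutive balls meet, so the k-th step
   of [q] is at most 2^-k. *)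
have [q hq] := boolp.choice (fun k => Fc _ (half_gt0 k.+1)).
have [|y [C hy]] := @Mc (fun k => mrep (q k)).
  move=> k; have [z [/=]] := filter_ex (filterI (hq k) (hq k.+1)).
  rewrite !ballEmdist /= => /ltW h1 /ltW h2; rewrite -mdist_quotE.
  apply: le_trans (metric_triangle _ z _) _; rewrite (metric_sym z).
  apply: le_trans (lerD h1 h2) _.
  have := half_gt0 k; rewrite !exprS; set a := 2^-1 ^+ k => a0.
  lra.
exists (mclass m y); apply/metricType_numDomainType.fcvgrPdist_lt => e e0.
have [k] := geometric_lt (C + 1) e0; rewrite mulrDl mul1r => ke.
apply: filterS (hq k); move=> z /=; rewrite ballEmdist /= => kz.
have := hy k; rewrite -(mdist_mclass m) mrepK metric_sym => yk.
apply: le_lt_trans (metric_triangle _ (q k) _) _; apply: le_lt_trans ke.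
apply: lerD yk _; apply: ltW; apply: lt_le_trans kz _.
rewrite exprS; have := half_gt0 k; set a := 2^-1 ^+ k => a0; lra.
Qed.

Lemma quot_bounded (p q : Q) : mdist p q <= dist_bound L.
Proof.
suff /andP[] : 0 <= mdist p q <= dist_bound L by [].
by apply: mean_itv => i; rewrite mdist_ge0 carrier_bounded.
Qed.

Definition quot_fun (f : fun_symb L) (a : 'I_(fun_arity f) -> Q) : Q :=
  mclass m (fun i => fun_interp (fun j => mrep (a j) i)).

Definition quot_pred (P : pred_symb L) (a : 'I_(pred_arity P) -> Q) : R :=
  m (fun i => pred_interp (fun j => mrep (a j) i)).

Lemma pdist_fun_le (f : fun_symb L) (x y : 'I_(fun_arity f) -> forall i, M i) :
  pdist m (fun i => fun_interp (x^~ i)) (fun i => fun_interp (y^~ i)) <=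
  @fun_modulus R L f (fun j => pdist m (x j) (y j)).
Proof.
apply: (@mean_modulus _ _ m _ _ (fun j i => mdist (x j i) (y j i))).
- exact: fun_modulusP.
- by move=> j; exact: bounded_mdist.
- by move=> j i; exact: mdist_ge0.
- exact: bounded_mdist.
- by move=> Z i; exact: fun_interp_split.
Qed.

Lemma bounded_pred_interp (P : pred_symb L)
    (x : 'I_(pred_arity P) -> forall i, M i) :
  bounded_map (fun i => pred_interp (x^~ i)).
Proof. by apply: bounded_map_itv => i; exact: pred_interp_bounded. Qed.

Lemma mean_pred_le (P : pred_symb L) (x y : 'I_(pred_arity P) -> forall i, M i) :
  `|m (fun i => pred_interp (x^~ i)) - m (fun i => pred_interp (y^~ i))| <=
  @pred_modulus R L P (fun j => pdist m (x j) (y j)).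
Proof.
(* The one-sided bound suffices, since the two tuples can be exchanged. *)
suff h (u v : 'I_(pred_arity P) -> forall i, M i) :
    m (fun i => pred_interp (u^~ i)) - m (fun i => pred_interp (v^~ i)) <=
    @pred_modulus R L P (fun j => pdist m (u j) (v j)).
  rewrite ler_norml h andbT lerNl opprB.
  have -> : (fun j => pdist m (x j) (y j)) = (fun j => pdist m (y j) (x j)).
    by apply/funext => j; rewrite pdist_sym.
  exact: h.
rewrite -meanB; try exact: bounded_pred_interp.
apply: (@mean_modulus _ _ m _ _ (fun j i => mdist (u j i) (v j i))).
- exact: pred_modulusP.
- by move=> j; exact: bounded_mdist.
- by move=> j i; exact: mdist_ge0.
- by apply: bounded_mapB; exact: bounded_pred_interp.
- by move=> Z i; apply: le_trans (ler_norm _) _; exact: pred_interp_split.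
Qed.

Lemma quot_fun_modulus (f : fun_symb L) (a b : 'I_(fun_arity f) -> Q) :
  mdist (quot_fun a) (quot_fun b) <=
  @fun_modulus R L f (fun i => mdist (a i) (b i)).
Proof.
rewrite mdist_mclass.
exact: (pdist_fun_le (fun j => mrep (a j)) (fun j => mrep (b j))).
Qed.

Lemma quot_pred_modulus (P : pred_symb L) (a b : 'I_(pred_arity P) -> Q) :
  `|quot_pred a - quot_pred b| <=
  @pred_modulus R L P (fun i => mdist (a i) (b i)).
Proof. exact: (mean_pred_le (fun j => mrep (a j)) (fun j => mrep (b j))). Qed.

Lemma quot_pred_bounded (P : pred_symb L) (a : 'I_(pred_arity P) -> Q) :
  pred_lower P <= quot_pred a <= pred_upper P.
Proof. by apply: mean_itv => i; exact: pred_interp_bounded. Qed.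

Definition mean_structure : structure L :=
  @Structure R L Q quot_nonempty quot_complete quot_bounded
    quot_fun quot_fun_modulus quot_pred quot_pred_modulus quot_pred_bounded.

Definition tuple_pi n (x : 'I_n -> forall i, M i) : 'I_n -> mean_structure :=
  fun j => mclass m (x j).

Lemma env_cons_pi n (b : forall i, M i) (x : 'I_n -> forall i, M i) :
  env_cons (mclass m b : mean_structure) (tuple_pi x) = tuple_pi (env_cons b x).
Proof.
by apply/funext => j; rewrite /env_cons /tuple_pi; case: unlift.
Qed.

Lemma env_cons_at n (b : forall i, M i) (x : 'I_n -> forall i, M i) i :
  (fun j => env_cons b x j i) = env_cons (b i) (fun j => x j i).
Proof. by apply/funext => j; rewrite /env_cons; case: unlift. Qed.

Lemma term_val_mean n (t : term L n) (x : 'I_n -> forall i, M i) :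
  term_val (tuple_pi x) t = mclass m (fun i => term_val (fun j => x j i) t).
Proof.
elim: t => [j|f ts IH] //=.
apply: mclass_eq; apply/eqP; rewrite eq_le pdist_ge0 andbT.
(* The representatives [u j] agree with the coordinatewise values [v j] only up to distance 0, which
   is enough because a modulus vanishes at 0. *)
pose u j := mrep (term_val (tuple_pi x) (ts j)).
pose v j := fun i => term_val (fun j => x j i) (ts j).
apply: le_trans (pdist_fun_le u v) _.
have [D0 _ _ _] := fun_modulusP f; rewrite -[leRHS]D0.
rewrite (_ : (fun j => _) = fun=> 0)//; apply/funext => j.
by rewrite -(mdist_mclass m) /u mrepK IH mdistxx.
Qed.

(** The quotient comes from the full product, so near-witnesses can be chosen independently in all
    coordinates; hence suprema commute with the mean. *)
Lemma mean_sup (G : Q -> R) (g : forall i, M i -> R) (B : R) :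
  (forall b : forall i, M i, G (mclass m b) = m (fun i => g i (b i))) ->
  (forall i y, `|g i y| <= B) ->
  sup (range G) = m (fun i => sup (range (g i))).
Proof.
move=> Gg gB.
have GB : bounded_map G.
  by exists B => q; rewrite -[q]mrepK Gg; apply: mean_norm => i; exact: gB.
have sB : bounded_map (fun i => sup (range (g i))).
  by exists B => i; apply: norm_sup_range_le => //; exact: carrier_nonempty.
have gB' (b : forall i, M i) : bounded_map (fun i => g i (b i)) by exists B.
apply/eqP; rewrite eq_le; apply/andP; split.
  apply: sup_range_le; first exact: quot_nonempty.
  move=> q; rewrite -[q]mrepK Gg; apply: mean_le => // i.
  by apply: le_sup_range; exists B.
apply/ler_addgt0Pr => e e0.
have bP i : exists y, sup (range (g i)) - e < g i y.
  by apply: sup_range_adherent => //; [exact: carrier_nonempty|exists B].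
pose b i := sval (cid (bP i)).
have hb i : sup (range (g i)) <= g i (b i) + e.
  by rewrite -lerBlDr ltW// /b; case: cid.
apply: le_trans (_ : m (fun i => g i (b i) + e) <= _).
  by apply: mean_le => //; apply: bounded_mapD => //; exact: bounded_map_cst.
rewrite meanD//; last exact: bounded_map_cst.
by rewrite mean_cst lerD2r -Gg; exact: le_sup_range.
Qed.

(** The Łoś theorem for affine formulas: affine connectives commute with a mean by linearity,
    quantifiers by [mean_sup]. A non-affine connective need not commute with a weighted mean. *)
Lemma form_val_mean n (phi : formula L affine_conn n)
    (x : 'I_n -> forall i, M i) :
  form_val phi (tuple_pi x) = m (fun i => form_val phi (fun j => x j i)).
Proof.
elim: phi x => {n} [n t1 t2|n P ts|n k u [c [r ur]] phis IH|n phi IH|n phi IH] x /=.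
- by rewrite !term_val_mean mdist_mclass.
- apply/eqP; rewrite -subr_eq0 -normr_le0.
  pose u j := mrep (term_val (tuple_pi x) (ts j)).
  pose v j := fun i => term_val (fun j => x j i) (ts j).
  apply: le_trans (mean_pred_le u v) _.
  have [D0 _ _ _] := pred_modulusP P; rewrite -[leRHS]D0.
  rewrite (_ : (fun j => _) = fun=> 0)//; apply/funext => j.
  by rewrite -(mdist_mclass m) /u mrepK term_val_mean mdistxx.
- rewrite ur.
  have pB l : bounded_map (fun i => form_val (phis l) (fun j => x j i)).
    by have [B hB] := aff_val_bounded (phis l); exists B.
  under [in RHS]eq_fun => i do rewrite ur.
  under [in RHS]eq_fun => i do under eq_bigr => l _ do rewrite mxE.
  rewrite mean_comb//; congr (_ + _); apply: eq_bigr => l _.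
  by rewrite mxE IH.
- have [B hB] := aff_val_bounded phi.
  apply: (mean_sup (g := fun i y => form_val phi (env_cons y (x^~ i)))
    (B := B)) => // b.
  rewrite env_cons_pi IH; congr (m _); apply/funext => i.
  by rewrite env_cons_at.
- have [B hB] := aff_val_bounded phi.
  rewrite inf_rangeE; under [in RHS]eq_fun => i do rewrite inf_rangeE.
  rewrite meanN; last first.
    exists B => i; apply: norm_sup_range_le; first exact: carrier_nonempty.
    by move=> y; rewrite normrN.
  congr (- _).
  apply: (mean_sup (g := fun i y => - form_val phi (env_cons y (x^~ i)))
    (B := B)) => [b|i y]; last by rewrite normrN.
  rewrite env_cons_pi IH -meanN; last by exists B.
  by congr (m _); apply/funext => i; rewrite env_cons_at.
Qed.

Lemma model_mean (T : theory L affine_conn) :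
  (forall i, model T (M i)) -> model T mean_structure.
Proof.
move=> MT c Tc; rewrite /holds_in /sentence_val.
have e0 : @env0 mean_structure = tuple_pi (@env0 (forall i, M i)).
  by apply/funext => -[].
have e1 i : (fun j => @env0 (forall i, M i) j i) = @env0 (M i).
  by apply/funext => -[].
rewrite e0 !form_val_mean; apply: mean_le.
- by have [B hB] := aff_val_bounded c.1; exists B.
- by have [B hB] := aff_val_bounded c.2; exists B.
- by move=> i; rewrite e1; exact: MT.
Qed.

End MeanStructureDef.

(** * Ultrafilters and weighted pairs *)

Section Modulus.
Context {R : realType} {n : nat} (D : ('I_n -> R) -> R).
Context (DP : convex_modulus D).

Lemma modulus_ge0 s : (forall i, 0 <= s i) -> 0 <= D s.
Proof.
by move=> s0; have [D0 _ Dle _] := DP; rewrite -D0 Dle// => i; rewrite lexx s0.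
Qed.

(** Concavity on the segment from 0 to [c * s], together with the value 0 of [D] at 0. *)
Lemma modulus_scale s (c : R) : (forall i, 0 <= s i) -> 1 <= c ->
  D (fun i => c * s i) <= c * D s.
Proof.
move=> s0 c1; have c0 : 0 < c by exact: lt_le_trans c1.
have [D0 _ _ Dconc] := DP.
have := Dconc (fun i => c * s i) (fun=> 0) c^-1.
rewrite D0 mulr0 addr0; have -> : (fun i => c^-1 * (c * s i) + 0) = s.
  by apply/funext => i; rewrite addr0 mulKf ?gt_eqF.
move=> h; rewrite -ler_pdivrMl// h//.
- by move=> i; rewrite mulr_ge0// ltW.
- by rewrite invr_ge0 ltW//= invf_le1.
Qed.

End Modulus.

(** * Limits along an ultrafilter *)

Section UltrafilterMean.
Context {R : realType} {I : Type} (F : set_system I) {FU : UltraFilter F}.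

Definition ulim (f : I -> R) : R := lim (f @ F).

(** The values stay in a compact interval, and an ultrafilter converges to each of its cluster
    points. *)
Lemma ulim_cvg f : bounded_map f -> f i @[i --> F] --> ulim f.
Proof.
move=> [B fB].
have [|p [_ clp]] := @segment_compact R (- B) B (f @ F) _.
  by apply: (@filterE _ F) => i /=; rewrite in_itv/= -ler_norml; exact: fB.
suff : f @ F --> p by move=> fp; apply: cvgP fp.
apply/cvgrPdist_lt => e e0.
have [//|Fn] := in_ultra_setVsetC [set i | `|p - f i| < e] FU.
have : f @` (~` [set i | `|p - f i| < e]) `&` ball p e !=set0.
  apply: clp; last exact: nbhsx_ballx.
  by apply: (@filterS _ F) Fn => i hi; exists i.
by move=> [_ [[i hi <-]]]; rewrite -ball_normE.
Qed.

Lemma ulimE f l : f i @[i --> F] --> l -> ulim f = l.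
Proof. exact: cvg_lim. Qed.

Lemma ulimD f g : bounded_map f -> bounded_map g ->
  ulim (fun i => f i + g i) = ulim f + ulim g.
Proof. by move=> fB gB; apply: ulimE; exact: cvgD (ulim_cvg fB) (ulim_cvg gB). Qed.

Lemma ulimZ c f : bounded_map f -> ulim (fun i => c * f i) = c * ulim f.
Proof. by move=> fB; apply: ulimE; exact: cvgMl_tmp (ulim_cvg fB). Qed.

Lemma ulim_le_near f g : bounded_map f -> bounded_map g ->
  (\forall i \near F, f i <= g i) -> ulim f <= ulim g.
Proof.
move=> fB gB fg; rewrite leNgt; apply/negP => /midf_lt [h1 h2].
have hf : \forall i \near F, (ulim g + ulim f) / 2 < f i.
  exact: cvgr_gt (ulim_cvg fB) _ h2.
have hg : \forall i \near F, g i < (ulim g + ulim f) / 2.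
  exact: cvgr_lt (ulim_cvg gB) _ h1.
have [i [/= [hi1 hi2] hi3]] := filter_ex (filterI (filterI hf hg) fg).
by have := lt_trans hi2 hi1; rewrite ltNge hi3.
Qed.

Lemma ulim_le f g : bounded_map f -> bounded_map g ->
  (forall i, f i <= g i) -> ulim f <= ulim g.
Proof. by move=> fB gB fg; apply: ulim_le_near => //; exact: filterE. Qed.

Lemma ulim_cst c : ulim (fun=> c) = c.
Proof. by apply: ulimE; exact: cvg_cst. Qed.

Lemma near_lt_ulim f c : bounded_map f -> ulim f < c -> \forall i \near F, f i < c.
Proof. by move=> fB fc; exact: cvgr_lt (ulim_cvg fB) _ fc. Qed.

(** The coordinates in [Z], those with limit 0, are absorbed by the continuity of [D] at 0. On the
    others [s j i < c * l j] holds near [F] for any [c > 1], and scaling the arguments by [c] costs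
    at most a factor [c]. *)
Lemma ulim_modulus n (D : ('I_n -> R) -> R) (s : 'I_n -> I -> R) (h : I -> R) :
  convex_modulus D -> (forall j, bounded_map (s j)) ->
  (forall j i, 0 <= s j i) -> bounded_map h ->
  (forall (Z : pred 'I_n) i,
    h i <= D (fun j => if Z j then s j i else 0) +
           D (fun j => if Z j then 0 else s j i)) ->
  ulim h <= D (fun j => ulim (s j)).
Proof.
move=> DP sB s0 hB hD; have [D0 Dc Dle _] := DP.
pose l j := ulim (s j).
have l0 j : 0 <= l j.
  by rewrite -[leLHS](ulim_cst 0); apply: ulim_le => //; exact: bounded_map_cst.
apply/ler_addgt0Pr => e e0.
pose Z j := l j == 0.
have [d d0 hd] := Dc (e / 2) (divr_gt0 e0 (ltr0n _ 2)).
have Dl0 : 0 <= D l by exact: modulus_ge0.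
(* This factor satisfies [c * D l <= D l + e / 2]; the added 1 keeps the denominator positive when
   [D l] is 0. *)
pose c := 1 + e / 2 / (D l + 1).
have c1 : 1 < c by rewrite ltrDl !divr_gt0// ltr_wpDl.
rewrite -[leRHS]ulim_cst; apply: ulim_le_near => //; first exact: bounded_map_cst.
have nearj j : \forall i \near F, if Z j then s j i < d else s j i < c * l j.
  rewrite /Z; case: eqVneq => lj; apply: near_lt_ulim => //.
    by rewrite -/(l j) lj.
  by rewrite -/(l j) ltr_pMl// lt_neqAle eq_sym lj l0.
have : \forall i \near F, forall j, if Z j then s j i < d else s j i < c * l j.
  exact: filter_forall nearj.
apply: filterS => i hi.
apply: le_trans (hD Z i) _.
have hl : D (fun j => if Z j then s j i else 0) <= e / 2.
  apply/ltW/hd => j; have := hi j; case: ifP => _; last by rewrite lexx d0.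
  by rewrite s0.
have hr : D (fun j => if Z j then 0 else s j i) <= c * D l.
  apply: le_trans (modulus_scale DP l0 (ltW c1)); apply: Dle => j.
  have := hi j; case: ifP => _ sj.
    by rewrite lexx mulr_ge0// ltW// (lt_trans _ c1).
  by rewrite s0 ltW.
apply: le_trans (lerD hl hr) _.
suff : c * D l <= D l + e / 2 by lra.
rewrite /c mulrDl mul1r lerD2l mulrAC -mulrA ler_piMr ?divr_ge0 ?ltW//.
by rewrite ltr_pdivrMr ?mul1r ?ltrDl// ltr_wpDl.
Qed.

Definition ulim_mean : mean R I :=
  Mean ulimD ulimZ ulim_le (ulim_cst 1) ulim_modulus.

(** A set of [F] can be asked to make only finitely many steps small at once. The limit is therefore
    taken coordinatewise from [geometric_prefix_lim], whose bound at [k] depends on the first [k]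
    steps only. *)
Lemma ulim_mean_complete (L : signature R) (M : I -> structure L) :
  mean_complete ulim_mean M.
Proof.
move=> x xc.
have two0 : 0 <= 2 :> R by [].
pose y i := sval (cid (geometric_prefix_lim (fun k => x k i) two0)).
have yP i := svalP (cid (geometric_prefix_lim (fun k => x k i) two0)).
exists y, (2 * 2) => k; rewrite -[leRHS]ulim_cst.
apply: ulim_le_near; [exact: bounded_mdist|exact: bounded_map_cst|].
(* The factor 2 makes the inequality strict, so that it passes from the limit to a set of [F]. *)
have near_k j : \forall i \near F, mdist (x j i) (x j.+1 i) < 2 * 2^-1 ^+ j.
  apply: near_lt_ulim; first exact: bounded_mdist.
  apply: le_lt_trans (xc j) _.
  by rewrite ltr_pMl ?ltr1n// exprn_gt0// invr_gt0.
have : \forall i \near F,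
    forall j : 'I_k, mdist (x j i) (x j.+1 i) < 2 * 2^-1 ^+ j.
  by apply: filter_forall => j; exact: near_k.
apply: filterS => i hi; apply: yP => j jk.
exact: ltW (hi (Ordinal jk)).
Qed.

End UltrafilterMean.

(** * Weighted pairs *)

Section BinaryMean.
Context {R : realType} (l : R) (l01 : 0 < l < 1).

Definition bin_val (f : bool -> R) : R := l * f true + (1 - l) * f false.

Lemma bounded_map_bool (f : bool -> R) : bounded_map f.
Proof.
exists (`|f true| + `|f false|) => -[]; first by rewrite lerDl.
by rewrite lerDr.
Qed.

Lemma bin_valD f g : bounded_map f -> bounded_map g ->
  bin_val (fun i => f i + g i) = bin_val f + bin_val g.
Proof. by move=> _ _; rewrite /bin_val; ring. Qed.

Lemma bin_valZ c f : bounded_map f -> bin_val (fun i => c * f i) = c * bin_val f.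
Proof. by move=> _; rewrite /bin_val; ring. Qed.

Lemma bin_val_le f g : bounded_map f -> bounded_map g ->
  (forall i, f i <= g i) -> bin_val f <= bin_val g.
Proof.
move=> _ _ fg; have /andP[l0 l1] := l01.
by apply: lerD; apply: ler_wpM2l => //; [exact: ltW|rewrite subr_ge0 ltW].
Qed.

Lemma bin_val1 : bin_val (fun=> 1) = 1.
Proof. by rewrite /bin_val; ring. Qed.

Lemma bin_val_modulus n (D : ('I_n -> R) -> R) (s : 'I_n -> bool -> R)
    (h : bool -> R) :
  convex_modulus D -> (forall j, bounded_map (s j)) ->
  (forall j i, 0 <= s j i) -> bounded_map h ->
  (forall (Z : pred 'I_n) i,
    h i <= D (fun j => if Z j then s j i else 0) +
           D (fun j => if Z j then 0 else s j i)) ->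
  bin_val h <= D (fun j => bin_val (s j)).
Proof.
(* The trivial splitting [pred0] gives back the plain modulus bound; concavity does the rest. *)
move=> [D0 _ _ Dconc] _ s0 _ /(_ pred0) /= hD; have /andP[l0 l1] := l01.
apply: le_trans (Dconc (s^~ true) (s^~ false) l _ _ _) => //; last first.
  by rewrite !ltW.
apply: (@bin_val_le h (fun i => D (s^~ i))); try exact: bounded_map_bool.
by move=> i; apply: le_trans (hD i) _; rewrite D0 add0r.
Qed.

Definition bin_mean : mean R bool :=
  Mean bin_valD bin_valZ bin_val_le bin_val1 bin_val_modulus.

Lemma bin_mean_complete (L : signature R) (M : bool -> structure L) :
  mean_complete bin_mean M.
Proof.
move=> x xc; have /andP[l0 l1] := l01; have l1' : 0 < 1 - l by rewrite subr_gt0.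
(* Both weights are positive, so a small mean distance is small in each coordinate, up to the
   inverse of its weight; [C] dominates both inverses. *)
pose C := l^-1 + (1 - l)^-1.
have C0 : 0 <= C by rewrite addr_ge0// invr_ge0 ltW.
have xC i k : mdist (x k i) (x k.+1 i) <= C * 2^-1 ^+ k.
  have := xc k; rewrite /pdist /= /bin_val; set e := 2^-1 ^+ k => h.
  have e0 : 0 <= e by rewrite exprn_ge0// invr_ge0.
  have ht : l * mdist (x k true) (x k.+1 true) <= e.
    apply: le_trans h; rewrite lerDl mulr_ge0// ?mdist_ge0//; exact: ltW.
  have hf : (1 - l) * mdist (x k false) (x k.+1 false) <= e.
    apply: le_trans h; rewrite lerDr mulr_ge0// ?mdist_ge0//; exact: ltW.
  rewrite -ler_pdivlMl// in ht; rewrite -ler_pdivlMl// in hf.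
  rewrite mulrDl; case: i; [apply: le_trans ht _|apply: le_trans hf _].
    by rewrite lerDl mulr_ge0// invr_ge0 ltW.
  by rewrite lerDr mulr_ge0// invr_ge0 ltW.
pose y i := sval (cid (geometric_lim C0 (xC i))).
have yP i := svalP (cid (geometric_lim C0 (xC i))).
exists y, (2 * C) => k.
suff /andP[] : 0 <= pdist bin_mean (x k) y <= 2 * C * 2^-1 ^+ k by [].
by apply: mean_itv => i; rewrite mdist_ge0 yP.
Qed.

End BinaryMean.

(** * Convex separation in the pointwise topology *)

Section PointwiseTopology.
Context {U : Type} {V : topologicalType}.

Lemma ptws_cvgP (F : set_system {ptws U -> V}) (FF : Filter F)
    (f : {ptws U -> V}) :
  F --> f <-> forall t, (fun g : {ptws U -> V} => g t) @ F --> f t.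
Proof.
have surj t : (fun g : U -> V => g t) @` setT = setT.
  by rewrite eqEsubset; split => // v _; exists (fun=> v).
split=> [/cvg_sup + t|Ff].
  move=> /(_ t); rewrite cvg_image//; apply: cvg_trans => W /=.
  by move=> [W' + <-]; apply: (@filterS _ F) => g W'g /=; exists g.
apply/cvg_sup => t. apply/cvg_image => [|W Wt]; first exact: surj.
have FW := Ff t W Wt.
exists (@^~ t @^-1` W) => //; rewrite eqEsubset.
by split=> [v [h + <-]//|v Wv]; exists (fun=> v).
Qed.

Lemma ptws_eval_continuous (t : U) : continuous (fun f : {ptws U -> V} => f t).
Proof. by move=> f; move: (@cvg_id _ (nbhs f)) => /ptws_cvgP /(_ t). Qed.

End PointwiseTopology.

(** * Separation of a point from the mixtures of two compact convex sets *)

Section ConvexSeparation.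
Context {R : realType} {U : Type}.
Local Notation X := {ptws U -> R}.
Implicit Types (p q : X) (s : seq U).

Definition mixt (l : R) p q : X := fun u => l * p u + (1 - l) * q u.

Definition mixt_closed (K : set X) := forall p q l,
  K p -> K q -> 0 <= l <= 1 -> K (mixt l p q).

Definition sqdist s q p : R := \sum_(u <- s) (p u - q u) ^+ 2.

Lemma sqdist_ge0 s q p : 0 <= sqdist s q p.
Proof. by apply: sumr_ge0 => u _; exact: sqr_ge0. Qed.

Lemma mixtC l p q : mixt (1 - l) p q = mixt l q p.
Proof. by apply/funext => u; rewrite /mixt; ring. Qed.

Lemma le0_of_small_slope (A B : R) : 0 <= B ->
  (forall t, 0 < t <= 1 -> 2 * A <= t * B) -> A <= 0.
Proof.
move=> B0 h; rewrite leNgt; apply/negP => A0.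
have AB0 : 0 < A + B by rewrite ltr_wpDr.
(* At t = A / (A + B) one has t B <= A < 2 A. *)
have /h : 0 < A / (A + B) <= 1.
  by rewrite divr_gt0//= ler_pdivrMr// mul1r lerDl.
have : A / (A + B) * B <= A.
  by rewrite mulrAC ler_pdivrMr// ler_pM2l// lerDr ltW.
lra.
Qed.

(* The first-order condition at the point of conv (K1 u K2) nearest to q. *)
Lemma nearest_mixt (K1 K2 : set X) s q l p1 p2 :
  mixt_closed K1 -> 0 <= l <= 1 -> K1 p1 -> K2 p2 ->
  (forall l' p1' p2', 0 <= l' <= 1 -> K1 p1' -> K2 p2' ->
    sqdist s q (mixt l p1 p2) <= sqdist s q (mixt l' p1' p2')) ->
  forall p, K1 p ->
    \sum_(u <- s) (q u - mixt l p1 p2 u) * (p u - mixt l p1 p2 u) <= 0.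
Proof.
move=> K1c /andP[l0 l1] Kp1 Kp2 zmin p Kp.
set c := mixt l p1 p2.
apply: (@le0_of_small_slope _ (\sum_(u <- s) (p u - c u) ^+ 2)).
  by apply: sumr_ge0 => u _; exact: sqr_ge0.
(* The point c + t (p - c) is again a mixture, with weight [l'] and component [p1'] in [K1].
   Comparing squared distances and dividing by [t] leaves the claim up to a multiple of [t]. *)
move=> t /andP[t0 t1]; pose l' := (1 - t) * l + t.
have tl0 : 0 <= (1 - t) * l by rewrite mulr_ge0// subr_ge0.
have l'0 : 0 < l' by rewrite ltr_wpDl.
have l'1 : l' <= 1 by rewrite /l'; nra.
pose p1' := mixt ((1 - t) * l / l') p1 p.
have Kp1' : K1 p1'.
  apply: K1c => //; rewrite divr_ge0 ?(ltW l'0)//= ler_pdivrMr// mul1r.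
  by rewrite lerDl ltW.
have := zmin l' p1' p2; rewrite (ltW l'0) l'1 => /(_ isT Kp1' Kp2).
have -> : mixt l' p1' p2 = fun u => c u + t * (p u - c u).
  apply/funext => u; rewrite /p1' /c /mixt.
  have -> : l' * ((1 - t) * l / l' * p1 u + (1 - (1 - t) * l / l') * p u) =
     (1 - t) * l * p1 u + (l' - (1 - t) * l) * p u.
    by field; rewrite gt_eqF.
  by rewrite /l'; ring.
rewrite -/c /sqdist -subr_ge0 -sumrB => h.
have : 0 <= \sum_(u <- s) (t * (- (2 * ((q u - c u) * (p u - c u))) +
    t * (p u - c u) ^+ 2)).
  apply: le_trans h _; apply: ler_sum => u _; rewrite le_eqVlt; apply/orP; left.
  by apply/eqP; ring.
rewrite -mulr_sumr pmulr_rge0// big_split/= -mulr_sumr sumrN -mulr_sumr.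
lra.
Qed.

Lemma mixt_continuous u :
  continuous (fun z : R * (X * X) => mixt z.1 z.2.1 z.2.2 u).
Proof.
move=> z; rewrite /mixt.
have c1 : (fun z : R * (X * X) => z.1) x @[x --> z] --> z.1 by exact: cvg_fst.
have c21 : (fun z : R * (X * X) => z.2.1 u) x @[x --> z] --> z.2.1 u.
  apply: (@cvg_comp _ _ _ (fun z => z.2.1) (fun p : X => p u)).
    by apply: (@cvg_comp _ _ _ snd fst); [exact: cvg_snd|exact: cvg_fst].
  exact: ptws_eval_continuous.
have c22 : (fun z : R * (X * X) => z.2.2 u) x @[x --> z] --> z.2.2 u.
  apply: (@cvg_comp _ _ _ (fun z => z.2.2) (fun p : X => p u)).
    by apply: (@cvg_comp _ _ _ snd snd); [exact: cvg_snd|exact: cvg_snd].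
  exact: ptws_eval_continuous.
apply: cvgD; first exact: cvgM c1 c21.
by apply: cvgM c22; apply: cvgB c1; exact: cvg_cst.
Qed.

Lemma sqdist_continuous s q :
  continuous (fun z : R * (X * X) => sqdist s q (mixt z.1 z.2.1 z.2.2)).
Proof.
rewrite /sqdist; apply: continuous_big => [|u _ z].
  exact: (@add_continuous R^o).
apply: (@cvgM R); apply: (@cvgB R R^o); try exact: cvg_cst.
  exact: mixt_continuous.
exact: mixt_continuous.
Qed.

(** By compactness, finitely many coordinates [s] already keep [q] apart from all mixtures. If [c]
    is the mixture nearest to [q] in these coordinates, the scalar product of q - c and p - c is the
    required affine function of [p]. *)
Lemma separate_mixt (K1 K2 : set X) q :
  compact K1 -> compact K2 -> mixt_closed K1 -> mixt_closed K2 ->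
  K1 !=set0 -> K2 !=set0 ->
  (forall l p1 p2, 0 <= l <= 1 -> K1 p1 -> K2 p2 -> q <> mixt l p1 p2) ->
  exists (c : R) (r : seq (R * U)),
    0 < c + \sum_(x <- r) x.1 * q x.2 /\
    forall p, K1 p \/ K2 p -> c + \sum_(x <- r) x.1 * p x.2 <= 0.
Proof.
move=> cK1 cK2 cvK1 cvK2 [k1 Kk1] [k2 Kk2] qN.
pose Z : set (R * (X * X)) := `[0, 1]%classic `*` (K1 `*` K2).
have cZ : compact Z.
  by apply: compact_setX; [exact: segment_compact|exact: compact_setX].
have ZE l p1 p2 : Z (l, (p1, p2)) <-> [/\ 0 <= l <= 1, K1 p1 & K2 p2].
  by rewrite /Z /=; split=> [[/= + []]|[? ? ?]]; rewrite /= ?in_itv.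
have Z0 : Z !=set0 by exists (0, (k1, k2)); apply/ZE; rewrite lexx ler01.
pose g s (z : R * (X * X)) := sqdist s q (mixt z.1 z.2.1 z.2.2).
have gcat s s' z : g (s ++ s') z = g s z + g s' z by rewrite /g /sqdist big_cat.
have g0 s z : 0 <= g s z by exact: sqdist_ge0.
have [[s gs]|noS] := pselect (exists s, forall z, Z z -> 0 < g s z).
  have [[l [p1 p2]] /[!inE] zZ zmin] :=
    compact_EVT_min Z0 cZ (continuous_subspaceT (@sqdist_continuous s q)).
  have {}zmin l' p1' p2' : 0 <= l' <= 1 -> K1 p1' -> K2 p2' ->
      sqdist s q (mixt l p1 p2) <= sqdist s q (mixt l' p1' p2').
    by move=> h1 h2 h3; apply: (zmin (l', (p1', p2'))); rewrite inE; apply/ZE.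
  have gz := gs _ zZ; move/ZE: zZ => [l01 Kp1 Kp2].
  set c := mixt l p1 p2.
  exists (- \sum_(u <- s) (q u - c u) * c u), [seq (q u - c u, u) | u <- s].
  have E p : - \sum_(u <- s) (q u - c u) * c u +
      \sum_(x <- [seq (q u - c u, u) | u <- s]) x.1 * p x.2 =
      \sum_(u <- s) (q u - c u) * (p u - c u).
    by rewrite big_map -sumrN -big_split; apply: eq_bigr => u _ /=; ring.
  rewrite E; split.
    apply: lt_le_trans gz _; rewrite le_eqVlt; apply/orP; left; apply/eqP.
    apply: eq_bigr => u _.
    by rewrite /= -/c; ring.
  move=> p Kp; rewrite E; case: Kp => Kp.
    exact: (nearest_mixt cvK1 l01 Kp1 Kp2 zmin).
  rewrite /c -(mixtC l p2 p1); apply: (nearest_mixt (K2 := K1) cvK2) => //.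
    by have /andP[? ?] := l01; apply/andP; split; lra.
  move=> l' p1' p2' /andP[l'0 l'1] K2p K1p; rewrite mixtC -(mixtC l').
  by apply: zmin => //; apply/andP; split; lra.
(* Otherwise every finite [s] has a mixture that agrees with [q] on [s]. These mixtures form a
   filter base on the compact [Z], and a cluster point of it represents [q] as a mixture. *)
have {}noS s : exists z, Z z /\ g s z = 0.
  apply: contrapT => h; apply: noS; exists s => z Zz.
  by rewrite lt_neqAle g0 andbT eq_sym; apply/eqP => gz; apply: h; exists z.
pose F := filter_from [set: seq U] (fun s => [set z | Z z /\ g s z = 0]).
have FF : ProperFilter F.
  apply: filter_from_proper; last by move=> s _; exact: noS.
  apply: filter_from_filter; first by exists [::].
  move=> s s' _ _; exists (s ++ s') => // z /= [Zz].
  rewrite gcat => /eqP; rewrite paddr_eq0 => [/andP[/eqP ? /eqP ?]|//|//].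
  by split.
have [|[l [p1 p2]] [/ZE[l01 Kp1 Kp2] clz]] := cZ F FF.
  by exists [::] => // z [].
have [] := qN l p1 p2 l01 Kp1 Kp2.
apply/funext => u; apply/esym.
have cl : closed [set z : R * (X * X) | mixt z.1 z.2.1 z.2.2 u = q u].
  apply: (@closed_comp _ _ _ [set q u]) => [z _|].
    exact: mixt_continuous.
  exact: closed_eq.
apply: (cl (l, (p1, p2))); move: clz; rewrite clusterE; apply.
exists [:: u] => // z [_]; rewrite /g /sqdist big_seq1 => /eqP.
by rewrite sqrf_eq0 subr_eq0 => /eqP.
Qed.

End ConvexSeparation.

(** * The convex set of affine types *)

Section AffineTypes.
Context {R : realType} {L : signature R} (T : theory L affine_conn).

(** The renaming [rho] lets a single ultraproduct compute the limit types of subtuples too, such as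
    the tuple that remains when a witness is removed. *)
Lemma ultraproduct_limit (I : Type) (F : set_system I) (FU : UltraFilter F)
    (M : I -> structure L) n (a : forall i, 'I_n -> M i) :
  (forall i, model T (M i)) ->
  exists (N : structure L) (e : 'I_n -> N), model T N /\
    forall n' (rho : 'I_n' -> 'I_n) (phi : formula L affine_conn n'),
      form_val phi (a i \o rho) @[i --> F] --> form_val phi (e \o rho).
Proof.
move=> MT; pose Mc := @ulim_mean_complete R I F FU L M.
exists (mean_structure Mc), (tuple_pi Mc (fun j i => a i j)); split.
  exact: model_mean.
move=> n' rho phi.
have -> : form_val phi (tuple_pi Mc (fun j i => a i j) \o rho) =
    ulim F (fun i => form_val phi (a i \o rho)).
  exact: (form_val_mean Mc phi (fun j i => a i (rho j))).
by apply: ulim_cvg; have [B hB] := aff_val_bounded phi; exists B.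
Qed.

Lemma aff_eval_continuous n (phi : formula L affine_conn n) :
  continuous (fun p : type_space L n => p phi).
Proof. exact: ptws_eval_continuous. Qed.

(** Every type is given a realisation; the ultraproduct of these realisations along [F] itself
    realises the limit of [F]. *)
Lemma compact_aff_types n : compact (aff_types T n).
Proof.
rewrite compact_ultra => F FU FT.
have [_ [M0 [a0 [M0T _]]]] := filter_ex FT.
have /boolp.choice[Ma hMa] : forall q : type_space L n,
    exists Ma : {M : structure L & 'I_n -> M},
    model T (projT1 Ma) /\ (aff_types T n q -> q = aff_type (projT2 Ma)).
  move=> q; have [[M [a [MT qa]]]|nq] := pselect (aff_types T n q).
    by exists (existT _ M a).
  (* A default outside [aff_types T n]; it does not affect the limit because [F] contains
     [aff_types T n]. *)
  by exists (existT _ M0 a0).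
have [N [e [NT Fe]]] := @ultraproduct_limit _ F FU
  (fun q => projT1 (Ma q)) n (fun q => projT2 (Ma q)) (fun q => (hMa q).1).
exists (aff_type e); split; first by exists N, e.
apply/ptws_cvgP => phi; have := Fe n id phi; apply: cvg_trans.
apply: near_eq_cvg; apply: filterS FT => q /(hMa q).2 qE.
exact: (congr1 (fun p : type_space L n => p phi) (esym qE)).
Qed.

(** The weighted product of two realisations realises the mixture. The weights 0 and 1 are treated
    apart because [bin_mean] has 0 < l < 1. *)
Lemma aff_types_mixt n : mixt_closed (aff_types T n).
Proof.
move=> p q l Tp Tq /andP[]; rewrite le_eqVlt => /predU1P[<- _|l0].
  by rewrite (_ : mixt 0 p q = q)//; apply/funext => phi; rewrite /mixt; ring.
rewrite le_eqVlt => /predU1P[->|l1].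
  by rewrite (_ : mixt 1 p q = p)//; apply/funext => phi; rewrite /mixt; ring.
have l01 : 0 < l < 1 by rewrite l0.
have [[M [a [MT ->]]] [N [b [NT ->]]]] := (Tp, Tq).
pose S (i : bool) := if i then M else N.
pose c (j : 'I_n) : forall i, S i := fun i => if i as i return S i then a j else b j.
pose Sc := @bin_mean_complete R l l01 L S.
exists (mean_structure Sc), (tuple_pi Sc c); split.
  by apply: model_mean => -[].
apply/funext => phi; exact/esym/(form_val_mean Sc phi c).
Qed.

Lemma aff_typesP n (q : type_space L n) : aff_types T n q ->
  exists (M : structure L) (a : 'I_n -> M),
    model T M /\ forall phi, q phi = form_val phi a.
Proof. by move=> [M [a [MT ->]]]; exists M, a. Qed.

Lemma affine_comb_conn (c : R) k (r : 'I_k -> R) :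
  affine_conn k (fun v : 'rV[R]_k => c + \sum_(i < k) r i * v 0 i).
Proof. by exists c, r. Qed.

Definition aff_comb n (c : R) (s : seq (R * formula L affine_conn n)) :
    formula L affine_conn n :=
  Conn (affine_comb_conn c (fun i : 'I_(size s) => (tnth (in_tuple s) i).1))
    (fun i => (tnth (in_tuple s) i).2).

(** Points of [type_space] are arbitrary functions on formulas; the linearity holds at [q] because
    some tuple realises it. *)
Lemma aff_combE n (c : R) (s : seq (R * formula L affine_conn n)) q :
  aff_types T n q -> q (aff_comb c s) = c + \sum_(x <- s) x.1 * q x.2.
Proof.
move=> /aff_typesP[M [a [_ qa]]]; rewrite qa /= [in RHS]big_tnth; congr (_ + _).
by apply: eq_bigr => i _; rewrite mxE qa.
Qed.

(* An extreme [q] is outside the convex hull of {phi1 <= 0} and {phi2 <= 0}, so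
   that an affine formula separates it from both. *)
Lemma slice_setI n (q : type_space L n) (phi1 phi2 : formula L affine_conn n) :
  extreme_types T n q -> 0 < q phi1 -> 0 < q phi2 ->
  exists psi : formula L affine_conn n, 0 < q psi /\
    forall p, aff_types T n p -> 0 < p psi -> 0 < p phi1 /\ 0 < p phi2.
Proof.
move=> [Tq qext] q1 q2.
pose K (phi : formula L affine_conn n) : set (type_space L n) :=
  aff_types T n `&` [set p | p phi <= 0].
(* If [K phi] is empty, [phi] is positive at all types and the other formula can serve as [psi]. *)
have Kne phi phi' : ~ (K phi !=set0) -> forall p, aff_types T n p -> 0 < p phi' ->
    0 < p phi /\ 0 < p phi'.
  move=> K0 p Tp p'; split=> //; rewrite ltNge; apply/negP => pphi.
  by apply: K0; exists p.
have [K1|/Kne K1] := pselect (K phi1 !=set0); last first.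
  by exists phi2; split=> // p; exact: K1.
have [K2|/Kne K2] := pselect (K phi2 !=set0); last first.
  by exists phi1; split=> // p Tp p1; have [] := K2 phi1 p Tp p1.
have Kc phi : compact (K phi).
  apply: compact_closedI; first exact: compact_aff_types.
  apply: (@closed_comp _ _ (fun p : type_space L n => p phi) [set x | x <= 0]).
    by move=> p _; exact: aff_eval_continuous.
  exact: closed_le.
have Km phi : mixt_closed (K phi).
  move=> p p' l [Tp /= hp] [Tp' /= hp'] /andP[l0 l1]; split.
    by apply: aff_types_mixt => //; rewrite l0.
  rewrite /= /mixt; nra.
have [|c [s [qs Ks]]] :=
  separate_mixt (q := q) (Kc phi1) (Kc phi2) (Km phi1) (Km phi2) K1 K2.
  (* At an endpoint [q] would lie in [K phi1] or [K phi2]. For 0 < l < 1 extremality gives p1 = p2,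
     so [q] equals [p1] and its value at [phi1] is at most 0. *)
  move=> l p1 p2 /andP[l0 l1] [Tp1 /= hp1] [Tp2 /= hp2] qE.
  have qphi phi : q phi = l * p1 phi + (1 - l) * p2 phi by rewrite qE.
  move: l0; rewrite le_eqVlt => /predU1P[l0|l0].
    by move: (qphi phi2); rewrite -l0 mul0r add0r subr0 mul1r => h; lra.
  move: l1; rewrite le_eqVlt => /predU1P[l1|l1].
    by move: (qphi phi1); rewrite l1 mul1r subrr mul0r addr0 => h; lra.
  have e : p1 = p2 by apply: (qext p1 p2 l) => //; rewrite l0.
  by move: (qphi phi1); rewrite -e => h; nra.
exists (aff_comb c s); rewrite aff_combE//; split=> // p Tp; rewrite aff_combE// => ps.
split; rewrite ltNge; apply/negP => hp; move: ps; rewrite ltNge Ks//.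
  by left.
by right.
Qed.

(** This is Choquet's lemma on slices. By [slice_setI] the slices through [q] generate a filter,
    which converges to [q] because each strip |p phi - q phi| < e is cut out by two slices. *)
Lemma extreme_slice n (q : type_space L n) (U : set (type_space L n)) :
  extreme_types T n q -> nbhs q U ->
  exists psi : formula L affine_conn n, 0 < q psi /\
    forall p, aff_types T n p -> 0 < p psi -> U p.
Proof.
move=> qext; have Tq := qext.1.
pose B (psi : formula L affine_conn n) : set (type_space L n) :=
  [set p | aff_types T n p /\ 0 < p psi].
pose G := filter_from [set psi : formula L affine_conn n | 0 < q psi] B.
have GF : Filter G.
  apply: filter_from_filter.
    by exists (aff_comb 1 [::]); rewrite /= aff_combE// big_nil addr0.
  move=> phi1 phi2 /= q1 q2; have [psi [qpsi hpsi]] := slice_setI qext q1 q2.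
  by exists psi => // p [Tp /(hpsi p Tp)[]].
suff Gq : G --> q.
  by move=> /Gq [psi qpsi hU]; exists psi; split=> // p Tp ppsi; exact: hU.
have half (c r : R) phi : 0 < c + r * q phi ->
    G [set p | 0 < c + r * p phi].
  move=> h; exists (aff_comb c [:: (r, phi)]); first by rewrite /= aff_combE// big_seq1.
  by move=> p [Tp]; rewrite aff_combE// big_seq1.
apply/ptws_cvgP => phi; apply/cvgrPdist_lt => e e0.
have h1 : G [set p | 0 < (q phi + e) + (-1) * p phi].
  by apply: half => //; lra.
have h2 : G [set p | 0 < (e - q phi) + 1 * p phi].
  by apply: half => //; lra.
apply: filterS (filterI h1 h2) => p [/= hp1 hp2].
by rewrite ltr_norml; apply/andP; split; lra.
Qed.

End AffineTypes.

(** * Continuous formulas on extremal models *)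

Section ExtremalModels.
Context {R : realType} {L : signature R} (T : theory L affine_conn).
Context (T_closed : forall n, closed_in (aff_types T n) (extreme_types T n)).

(** Nothing is asked at a [p] that no extremal model realises, so [r] is unique only if types
    realised in extremal models occur in every neighbourhood of [q]. *)
Definition type_limit n (g : forall M : structure L, ('I_n -> M) -> R)
    (q : type_space L n) (r : R) :=
  forall e, 0 < e -> \forall p \near q, forall (M : structure L) (a : 'I_n -> M),
    extremal_model T M -> p = aff_type a -> `|g M a - r| < e.

(* On extremal models, [g] extends to a continuous function of the extreme
   affine type. *)
Definition type_continuous n (g : forall M : structure L, ('I_n -> M) -> R) :=
  exists B, (forall M a, `|g M a| <= B) /\
    forall q, extreme_types T n q -> exists r, `|r| <= B /\ type_limit g q r.

Lemma type_limit_eq n (g : forall M : structure L, ('I_n -> M) -> R)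
    (q : type_space L n) r (M : structure L) (a : 'I_n -> M) :
  extremal_model T M -> q = aff_type a -> type_limit g q r -> g M a = r.
Proof.
move=> MT qa gr; apply/eqP; rewrite -subr_eq0 -normr_le0.
apply/ler_addgt0Pr => e e0; rewrite add0r ltW//.
exact: (nbhs_singleton (gr e e0)).
Qed.

Lemma type_continuous_eq n (g : forall M : structure L, ('I_n -> M) -> R)
    (M N : structure L) (a : 'I_n -> M) (b : 'I_n -> N) :
  type_continuous g -> extremal_model T M -> extremal_model T N ->
  aff_type a = aff_type b -> g M a = g N b.
Proof.
move=> [B [_ gq]] MT NT ab; have [r [_ gr]] := gq _ (MT.2 n a).
by rewrite (type_limit_eq MT erefl gr) (type_limit_eq NT ab gr).
Qed.

Lemma env_cons_lift (M : Type) n (e : 'I_n.+1 -> M) :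
  env_cons (e ord0) (e \o lift ord0) = e.
Proof.
apply/funext => i; rewrite /env_cons; case: unliftP => [j ->|->] //=.
Qed.

Lemma env_consK (M : Type) n (c : M) (a : 'I_n -> M) :
  env_cons c a \o lift ord0 = a.
Proof. by apply/funext => i; rewrite /env_cons /= liftK. Qed.

(* Compactness of the affine types and closedness of the extreme ones let the
   witnesses accumulate at an extreme type over [p]. *)
Lemma witness_limit n (p : type_space L n)
    (Acc : forall M : structure L, ('I_n -> M) -> M -> Prop) :
  (forall U, nbhs p U -> exists (M : structure L) (a : 'I_n -> M) (c : M),
    [/\ extremal_model T M, U (aff_type a) & Acc M a c]) ->
  exists (N : structure L) (a : 'I_n -> N) (c : N),
    [/\ model T N, p = aff_type a, extreme_types T n.+1 (aff_type (env_cons c a))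
      & forall V, nbhs (aff_type (env_cons c a) : type_space L n.+1) V ->
        exists (M : structure L) (a' : 'I_n -> M) (c' : M),
          [/\ extremal_model T M, V (aff_type (env_cons c' a')) & Acc M a' c']].
Proof.
move=> pAcc.
pose A : set (type_space L n) := [set p' | exists (M : structure L) (a : 'I_n -> M)
  (c : M), [/\ extremal_model T M, p' = aff_type a & Acc M a c]].
have [M0 [a0 [c0 [M0T _ Acc0]]]] := pAcc setT filterT.
have /boolp.choice[W hW] : forall p' : type_space L n,
    exists W : {M : structure L & (('I_n -> M) * M)%type},
    [/\ extremal_model T (projT1 W), Acc _ (projT2 W).1 (projT2 W).2 &
        A p' -> p' = aff_type (projT2 W).1].
  move=> p'; have [[M [a [c [MT pa Mac]]]]|nA] := pselect (A p').
    by exists (existT _ M (a, c)).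
  by exists (existT _ M0 (a0, c0)).
(* By hypothesis [A], the set of types that carry a witness for [Acc], meets every neighbourhood of
   [p]. An ultrafilter on it that converges to [p] indexes the ultraproduct. *)
have FA : ProperFilter (within A (nbhs p)).
  apply: Build_ProperFilter_ex => // P; rewrite /within/= => wP.
  have [M [a [c [MT h Mac]]]] := pAcc _ wP.
  by exists (aff_type a); apply: h; exists M, a, c.
have [G [GU sG]] := ultraFilterLemma FA.
have GA : G A by apply: sG; apply: (@filterE _ (nbhs p)) => p'.
have Gp : G --> p by move=> V pV; apply: sG; apply: filterS pV.
have [N [e [NT Ge]]] := @ultraproduct_limit _ _ T _ G GU
  (fun p' => projT1 (W p')) n.+1
  (fun p' => env_cons (projT2 (W p')).2 (projT2 (W p')).1)
  (fun p' => let: And3 h _ _ := hW p' in h.1).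
pose t p' : type_space L n.+1 :=
  aff_type (env_cons (projT2 (W p')).2 (projT2 (W p')).1).
have text p' : extreme_types T n.+1 (t p') by have [MT _ _] := hW p'; exact: MT.2.
have tq : t @ G --> (aff_type e : type_space L n.+1).
  by apply/ptws_cvgP => phi; exact: (Ge _ id phi).
exists N, (e \o lift ord0), (e ord0); rewrite env_cons_lift; split=> //.
(* The values of [phi] along [G] converge both to [p phi] and to its value at the tuple below the
   limit witness. *)
- apply/funext => phi; apply: (@cvg_unique R _ (@^~ phi @ G)) => //.
    exact: (cvg_trans (cvg_app _ Gp) (@aff_eval_continuous _ _ _ phi p)).
  apply: cvg_trans (Ge _ (lift ord0) phi); apply: near_eq_cvg.
  apply: filterS GA => p' Ap'; have [_ _ /(_ Ap') pW] := hW p'.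
  rewrite env_consK.
  exact: (congr1 (fun q : type_space L n => q phi) (esym pW)).
- have Te : aff_types T n.+1 (aff_type e) by exists N, e.
  (* Relative closedness gives a closed [V] of the whole space with the same trace on [aff_types] as
     the extreme types. *)
  have /closed_subspaceP[V cV VE] := @T_closed n.+1.
  suff Ve : V (aff_type e).
    have : (V `&` aff_types T n.+1) (aff_type e) by [].
    by rewrite VE => -[].
  apply: (closed_cvg V cV _ _ tq); apply: filterE => p'.
  have : (extreme_types T n.+1 `&` aff_types T n.+1) (t p').
    by split=> //; have [] := text p'.
  by rewrite -VE => -[].
- move=> V /tq GV; have [p' Vp'] := @filter_ex _ G _ (t @^-1` V) GV.
  have [MT Mac _] := hW p'.
  by exists (projT1 (W p')), (projT2 (W p')).1, (projT2 (W p')).2.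
Qed.

Lemma type_continuous_affine n (phi : formula L affine_conn n) :
  type_continuous (fun M a => form_val phi a).
Proof.
have [B hB] := aff_val_bounded phi; exists B; split=> // q [Tq _].
exists (q phi); split; first by have [M [a [_ ->]]] := aff_typesP Tq; exact: hB.
move=> e e0.
have /cvgrPdist_lt /(_ e e0) :
    (fun p : type_space L n => p phi) p @[p --> q] --> q phi.
  exact: aff_eval_continuous.
by apply: filterS => p + M a _ pa; rewrite distrC pa.
Qed.

Lemma type_continuousN n (g : forall M : structure L, ('I_n -> M) -> R) :
  type_continuous g -> type_continuous (fun M a => - g M a).
Proof.
move=> [B [gB gq]]; exists B; split=> [M a|q /gq[r [rB gr]]].
  by rewrite normrN.
exists (- r); rewrite normrN; split=> // e /gr.
by apply: filterS => p h M a MT pa; rewrite -opprD normrN; exact: h.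
Qed.

Lemma type_continuous_conn n k (u : 'rV[R]_k -> R)
    (g : 'I_k -> forall M : structure L, ('I_n -> M) -> R) :
  continuous u -> (forall i, type_continuous (g i)) ->
  type_continuous (fun M a => u (\row_i g i M a)).
Proof.
move=> cu /boolp.choice[B gB]; have [C uC] := continuous_box_bounded B cu.
exists C; split=> [M a|q qext].
  by apply: uC => i; rewrite mxE; exact: (gB i).1.
have /boolp.choice[r hr] := fun i => (gB i).2 q qext.
exists (u (\row_i r i)); split.
  by apply: uC => i; rewrite mxE; exact: (hr i).1.
move=> e e0.
have /cvgrPdist_lt /(_ e e0) /nbhs_ballP[d /= d0 hd] := cu (\row_i r i).
have : \forall p \near q, forall i (M : structure L) (a : 'I_n -> M),
    extremal_model T M -> p = aff_type a -> `|g i M a - r i| < d.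
  exact: filter_forall (fun i => (hr i).2 d d0).
apply: filterS => p h M a MT pa; rewrite distrC; apply: hd.
by split=> // i j; rewrite !mxE -ball_normE /= distrC; exact: h.
Qed.

Lemma type_continuous_sup n (g : forall M : structure L, ('I_n.+1 -> M) -> R) :
  type_continuous g ->
  type_continuous
    (fun (M : structure L) a => sup (range (fun c : M => g M (env_cons c a)))).
Proof.
move=> [B [gB gq]]; exists B; split=> [M a|p pext].
  by apply: norm_sup_range_le => //; exact: carrier_nonempty.
(* The limits of [g] at the extreme types above [p]. The bound by [B] is part of the definition
   because a limit need not be unique; it keeps the supremum finite. *)
pose over (r : R) := `|r| <= B /\ exists (N : structure L) (a : 'I_n -> N) (c : N),
  [/\ model T N, p = aff_type a, extreme_types T n.+1 (aff_type (env_cons c a)) &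
      type_limit g (aff_type (env_cons c a)) r].
pose r := sup over.
(* Witnesses found arbitrarily near [p] produce an element of [over] that values of [g] at such
   witnesses approximate. *)
have overW (Acc : forall M : structure L, ('I_n -> M) -> M -> Prop) :
    (forall U, nbhs p U -> exists (M : structure L) (a : 'I_n -> M) (c : M),
      [/\ extremal_model T M, U (aff_type a) & Acc M a c]) ->
    exists2 s, over s & forall e, 0 < e ->
      exists (M : structure L) (a : 'I_n -> M) (c : M),
        Acc M a c /\ `|g M (env_cons c a) - s| < e.
  move=> /witness_limit[N [a [c [NT pa qext qAcc]]]].
  have [s [sB gs]] := gq _ qext.
  exists s; first by split=> //; exists N, a, c.
  move=> e /gs /qAcc[M [a' [c' [MT h Mac]]]].
  by exists M, a', c'; split=> //; exact: h.
have over_le s : over s -> s <= r.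
  move=> os; apply: ub_le_sup => //.
  by exists B => x [xB _]; exact: le_trans (ler_norm _) xB.
have rB : `|r| <= B.
  have [[s os]|ne] := pselect (over !=set0); last first.
    (* The supremum of the empty set is 0 by default, and [B] is nonnegative because it bounds the
       norm of a value of [g]. *)
    rewrite /r sup_out => [|[]//]; rewrite normr0.
    have [M [a [MT _]]] := pext.1.
    by apply: le_trans (gB M (fun=> sval (cid (carrier_nonempty M)))).
  rewrite ler_norml; apply/andP; split.
    by apply: le_trans (over_le _ os); case: os; rewrite ler_norml => /andP[].
  apply: ge_sup; first by exists s.
  by move=> x [xB _]; exact: le_trans (ler_norm _) xB.
exists r; split=> // e e0.
have e20 : 0 < e / 2 by rewrite divr_gt0.
have upper : \forall p' \near p, forall (M : structure L) (a : 'I_n -> M) (c : M),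
    extremal_model T M -> p' = aff_type a -> g M (env_cons c a) <= r + e / 2.
  (* Witnesses with values above r + e/2 near [p] would accumulate at an element of [over] larger
     than [r]. *)
  apply: contrapT => nup.
  have [|s os sAcc] := overW (fun M a c => r + e / 2 < g M (env_cons c a)).
    move=> U pU; apply: contrapT => nU; apply: nup.
    apply: filterS pU => p' Up' M a c MT pa; rewrite leNgt; apply/negP => h.
    by apply: nU; exists M, a, c; rewrite -pa.
  have [M [a [c [Mac]]]] := sAcc _ e20.
  by rewrite ltr_norml => /andP[_ h]; have := over_le _ os; lra.
(* The term e/2 is lost in choosing an element [s] of [over] close to [r], and e/4 in approximating
   [s] by a value of [g]. *)
have lower : \forall p' \near p, forall (M : structure L) (a : 'I_n -> M),
    extremal_model T M -> p' = aff_type a ->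
    exists c, r - e / 2 - e / 4 < g M (env_cons c a).
  have [ne|ne] := pselect (over !=set0); last first.
    (* If [over] is empty, no tuple of an extremal model has its type near [p], and the bound holds
       vacuously. *)
    apply: contrapT => nlow; apply: ne.
    have [|s os _] := overW (fun M a c => True); last by exists s.
    move=> U pU; apply: contrapT => nU; apply: nlow.
    apply: filterS pU => p' Up' M a MT pa; exfalso; apply: nU.
    by exists M, a, (sval (cid (carrier_nonempty M))); rewrite -pa.
  have [|s os rs] := @sup_adherent _ over (e / 2) e20.
    by split=> //; exists B => x [xB _]; exact: le_trans (ler_norm _) xB.
  have [_ [N [a0 [c0 [NT pa0 qext qs]]]]] := os.
  (* On the slice given by [psi], [g] is within e/4 of [s]. The witness [c0] makes [Sup psi]
     positive at [p], hence near [p]. *)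
  have [|psi [qpsi hpsi]] := extreme_slice qext (qs (e / 4) _).
    by rewrite divr_gt0.
  have [C hC] := aff_val_bounded psi.
  have psup : 0 < p (Sup psi).
    rewrite pa0; apply: lt_le_trans qpsi _.
    apply: (@le_sup_range _ _ (fun b => form_val psi (env_cons b a0)) c0).
    by exists C.
  have pnear : \forall p' \near p, 0 < p' (Sup psi).
    exact: (@cvgr_gt R _ (nbhs p) _ (fun p' : type_space L n => p' (Sup psi))
      _ (@aff_eval_continuous _ _ _ (Sup psi) p) 0 psup).
  apply: (@filterS _ (nbhs p) _ _ _ _ pnear) => p' p'0 M a MT pa.
  pose f b := form_val psi (env_cons b a).
  have f0 : 0 < sup (range f) by move: p'0; rewrite pa.
  have fB : bounded_map f by exists C => b; exact: hC.
  (* The tolerance is the supremum itself, so the witness [c] satisfies [0 < f c] and its type lies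
     in the slice. *)
  have [c] := sup_range_adherent (carrier_nonempty M) fB f0.
  rewrite subrr => psic; exists c.
  have : aff_types T n.+1 (aff_type (env_cons c a)).
    by exists M, (env_cons c a); split=> //; exact: MT.1.
  move=> /hpsi /(_ psic M _ MT erefl); rewrite ltr_norml => /andP[h _].
  by rewrite -/r in rs; lra.
apply: filterS (filterI upper lower) => p' /= [up low] M a MT pa.
have h1 : sup (range (fun c : M => g M (env_cons c a))) <= r + e / 2.
  apply: sup_range_le; first exact: carrier_nonempty.
  by move=> c; exact: up.
have [c hc] := low M a MT pa.
have h2 : g M (env_cons c a) <= sup (range (fun c : M => g M (env_cons c a))).
  by apply: (@le_sup_range _ _ (fun c : M => g M (env_cons c a))); exists B.
by rewrite ltr_norml; apply/andP; split; lra.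
Qed.

Lemma type_continuous_form n (phi : formula L continuous_conn n) :
  type_continuous (fun M a => form_val phi a).
Proof.
elim: phi => {n} [n t1 t2|n P ts|n k u cu phis IH|n phi IH|n phi IH].
- exact: (type_continuous_affine (Dist affine_conn t1 t2)).
- exact: (type_continuous_affine (Pred affine_conn ts)).
- exact: (type_continuous_conn cu IH).
- exact: (type_continuous_sup IH).
- have := type_continuousN (type_continuous_sup (type_continuousN IH)).
  congr type_continuous; apply: functional_extensionality_dep => M.
  by apply/funext => a /=; rewrite inf_rangeE.
Qed.

End ExtremalModels.

(** * Elementarity, equivalence and completeness for extremal models *)

Theorem theorem14p5 (R : realType) (L : signature R)
    (T : theory L affine_conn)
    (T_closed : forall n : nat,
      closed_in (aff_types T n) (extreme_types T n)) :
  (forall M N : structure L, extremal_model T M -> extremal_model T N ->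
     (forall h : M -> N,
        elementary affine_conn h -> elementary continuous_conn h) /\
     (equivalent affine_conn M N -> equivalent continuous_conn M N)) /\
  (complete_theory T -> complete_theory (theory_ext T)).
Proof.
(* Affine equivalence is equality of the affine types of the empty tuple. *)
have eqv (M N : structure L) : extremal_model T M -> extremal_model T N ->
    equivalent affine_conn M N -> equivalent continuous_conn M N.
  move=> MT NT MN phi.
  apply: (type_continuous_eq (type_continuous_form T_closed phi) MT NT).
  exact/funext.
split=> [M N MT NT|Tc M N MT NT phi].
  split=> [h [hemb haff]|]; last exact: eqv.
  split=> // n phi a.
  apply: (type_continuous_eq (type_continuous_form T_closed phi) MT NT).
  by apply/funext => psi; exact: haff.
have hc (c : R) : continuous_conn 0 (fun=> c) by exact: cst_continuous.
pose cst c : formula L continuous_conn 0 := Conn (hc c)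
  (fun i => match notF (ltn_ord i) with end).
(* Without extremal models [theory_ext T] contains every condition, in particular 1 <= 0, and has no
   model. *)
have [[K KT]|noK] := pselect (exists K, extremal_model T K); last first.
  have ext c : theory_ext T c by move=> K KT; case: noK; exists K.
  have := MT _ (ext (cst 1, cst 0)); rewrite /holds_in /sentence_val /=; lra.
suff h (N' : structure L) : model (theory_ext T) N' ->
    sentence_val N' phi = sentence_val K phi by rewrite !h.
move=> N'T; have eqK K' : extremal_model T K' ->
    sentence_val K' phi = sentence_val K phi.
  by move=> K'T; apply: eqv => //; apply: Tc; [exact: K'T.1|exact: KT.1].
(* All extremal models give [phi] its value in [K], so both inequalities between [phi] and this
   constant belong to [theory_ext T]. *)
apply/eqP; rewrite eq_le; apply/andP; split.
  apply: (N'T (phi, cst (sentence_val K phi))) => K' K'T.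
  by rewrite /holds_in /= eqK.
apply: (N'T (cst (sentence_val K phi), phi)) => K' K'T.
by rewrite /holds_in /= eqK.
Qed.
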